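(* Let $1/2<p<\infty$. If $\varphi\in Y_p$, then $Q_\varphi\in\boldsymbol{S}_p$.
   Context: For a locally integrable complex-valued function $\varphi$ on $\mathbb{R}_+=(0,\infty)$, the operator $Q_\varphi$ is defined on bounded functions $f$ with compact support in $\mathbb{R}_+$ by $(Q_\varphi f)(x)=\int_0^\infty\varphi(\max\{x,y\})f(y)\,dy$. Writing $Q_\varphi\in\boldsymbol{S}_p$ means that it extends to a bounded operator on $L^2(\mathbb{R}_+)$ belonging to $\boldsymbol{S}_p$. $\boldsymbol{S}_p$, $0<p<\infty$, is the Schatten--von Neumann class: bounded operators $T$ with $\sum_{n\ge0}s_n(T)^p<\infty$, where $s_n(T)=\inf\{\|T-R\|:\operatorname{rank}R\le n\}$. For $0<p<\infty$, $X_p$ is the space of all measurable functions $\varphi$ on $\mathbb{R}_+$ such that $$\sum_{n\in\mathbb{Z}}2^{np/2}\Bigl(\int_{2^n}^{2^{n+1}}|\varphi(x)|^2dx\Bigr)^{p/2}<\infty .$$ $Y_p$ is the linear subspace of $X_p$ spanned by the non-increasing functions in $X_p$; that is, $\varphi\in Y_p$ if and only if $\operatorname{Re}\varphi$ and $\operatorname{Im}\varphi$ are both differences of non-increasing functions in $X_p$. *)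

(* Defs.v *)
From mathcomp Require Export all_boot all_order all_algebra.
From mathcomp Require Export complex.
From mathcomp Require Export all_classical all_reals all_analysis.

Set Implicit Arguments.
Unset Strict Implicit.
Unset Printing Implicit Defensive.

Import Order.TTheory GRing.Theory Num.Theory.
Import numFieldNormedType.Exports.

Local Open Scope classical_set_scope.
Local Open Scope ring_scope.

Section Defs.
Variable R : realType.

Local Notation C := (R[i])%type.
Local Notation mu := (@lebesgue_measure R).

(* Functions on the half-line are represented by functions on R of which only
   the values on [halfline] matter, and elements of L^2 by representatives:
   equality in L^2 is [ae_eq mu halfline]. *)
Definition halfline : set R := `]0, +oo[.

Definition cabs (z : C) : R := ComplexField.Normc.normc z.

Definition cmeasurable (f : R -> C) : Prop :=
  measurable_fun halfline (fun x => complex.Re (f x)) /\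
  measurable_fun halfline (fun x => complex.Im (f x)).

Definition cintegral (f : R -> C) : C :=
  Complex (Rintegral mu halfline (fun x => complex.Re (f x)))
          (Rintegral mu halfline (fun x => complex.Im (f x))).

Definition l2norm (f : R -> C) : \bar R :=
  poweR (\int[mu]_(x in halfline) ((cabs (f x)) ^+ 2)%:E)%E 2^-1.

Definition L2 (f : R -> C) : Prop := cmeasurable f /\ (l2norm f < +oo)%E.

(* Linearity and boundedness force [T] to respect almost-everywhere equality,
   so [T] induces a bounded operator on the quotient space L^2; the values of
   [T] outside [L2] are irrelevant. *)
Definition bounded_operator (T : (R -> C) -> (R -> C)) : Prop :=
  [/\ forall f, L2 f -> L2 (T f),
      forall (a : C) f g, L2 f -> L2 g ->
        ae_eq mu halfline (T (fun x => a * f x + g x))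
                          (fun x => a * T f x + T g x)
    & exists M : R, forall f, L2 f -> (l2norm (T f) <= M%:E * l2norm f)%E].

Definition opnorm (T : (R -> C) -> (R -> C)) : \bar R :=
  ereal_sup [set l2norm (T f) | f in [set f | L2 f /\ (l2norm f <= 1)%E]].

(* The range of [T] is contained in the span of n vectors of L^2. *)
Definition rank_le (n : nat) (T : (R -> C) -> (R -> C)) : Prop :=
  exists g : 'I_n -> R -> C, (forall i, L2 (g i)) /\
    forall f, L2 f -> exists c : 'I_n -> C,
      ae_eq mu halfline (T f) (fun x => \sum_(i < n) c i * g i x).

Definition singular_number (n : nat) (T : (R -> C) -> (R -> C)) : \bar R :=
  ereal_inf [set opnorm (fun f x => T f x - K f x) |
             K in [set K | bounded_operator K /\ rank_le n K]].

Definition schatten (p : R) (T : (R -> C) -> (R -> C)) : Prop :=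
  bounded_operator T /\
  (\sum_(0 <= n <oo) poweR (singular_number n T) p < +oo)%E.

Definition bounded_compact_support (f : R -> C) : Prop :=
  [/\ cmeasurable f,
      exists M : R, forall x, halfline x -> cabs (f x) <= M
    & exists K : set R, [/\ compact K, K `<=` halfline &
        forall x, halfline x -> ~ K x -> f x = 0]].

Definition Qop (phi : R -> C) (f : R -> C) : R -> C :=
  fun x => cintegral (fun y => phi (Num.max x y) * f y).

Definition Q_in_schatten (p : R) (phi : R -> C) : Prop :=
  exists T : (R -> C) -> (R -> C), schatten p T /\
    forall f, bounded_compact_support f -> ae_eq mu halfline (T f) (Qop phi f).

Definition Xp (p : R) (phi : R -> C) : Prop :=
  cmeasurable phi /\
  (\esum_(n in [set: int])
     ((2 `^ (n%:~R * p / 2))%:E *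
      poweR (\int[mu]_(x in `[(2 : R) ^ n, (2 : R) ^ (n + 1)])
               ((cabs (phi x)) ^+ 2)%:E) (p / 2)) < +oo)%E.

Definition nonincreasing_Xp (p : R) (g : R -> R) : Prop :=
  {in halfline &, {homo g : x y /~ x <= y}} /\ Xp p (fun x => (g x)%:C%C).

(* The decomposition is required almost everywhere only: elements of [Xp] are
   identified when equal almost everywhere. *)
Definition Yp (p : R) (phi : R -> C) : Prop :=
  Xp p phi /\
  exists g1 g2 h1 h2 : R -> R,
    [/\ nonincreasing_Xp p g1, nonincreasing_Xp p g2,
        nonincreasing_Xp p h1, nonincreasing_Xp p h2 &
        ae_eq mu halfline (fun x => complex.Re (phi x)) (fun x => g1 x - g2 x) /\
        ae_eq mu halfline (fun x => complex.Im (phi x)) (fun x => h1 x - h2 x)].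

End Defs.

(* Main.v *)
Require Import Defs.
From mathcomp Require finmap.
From mathcomp Require Import measurable_realfun.
From mathcomp Require Import ring lra zify.
Set Implicit Arguments.
Unset Strict Implicit.
Unset Printing Implicit Defensive.
Import Order.TTheory GRing.Theory Num.Theory.
Import numFieldNormedType.Exports.
Local Open Scope classical_set_scope.
Local Open Scope ring_scope.

(** The function phi agrees almost everywhere with a function Phi whose values
and variation are controlled by one nonnegative nonincreasing function g, the
sum of the four monotone functions given by the definition of Y_p: for x <= y,
|Phi y - Phi x| <= g x - g y, and |Phi x| <= g x.  That the four pieces lie in
X_p means that the numbers b_n = 2^n g(2^n), n in Z, are p-summable
([nonincreasing_Xp_sum_le], [Yp_dominated]).

Fix a threshold eps, and cut each dyadic interval [2^n, 2^(n+1)) with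
b_n >= eps both into m_n = floor (sqrt (b_n / eps)) pieces of equal length and
into pieces on which g varies by at most g(2^n) / m_n.  Since x and - g(x) both
increase with x, the common refinement has at most 2 m_n cells, and they can be
labelled by an increasing function.  Consider the kernel equal to Phi x or
Phi y, according to which of x and y has the larger label, and to 0 if that
label belongs to a dyadic interval with b_n < eps.  Its rank is at most
N(eps) = 4 sum_n m_n.  It differs from Phi(max(x, y)) in two places only: when x
and y are in the same cell, where the difference is at most g(2^n) / m_n on a
square of side at most 2^n / m_n, and the product b_n / m_n^2 of these numbers
is at most 4 eps; and when max(x, y) lies in a dyadic interval with b_n < eps,
where it is at most 2 eps / max(x, y), a multiple of Hardy's kernel.  Schur's
test ([schur_test]) with the weight x^(-1/2) bounds the norm of the difference
by a multiple of eps ([schur_bounded_diff]).  Hence s_N <= 48 eps for all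
N >= N(eps) ([singular_number_max_kernel_le]).

Finally, for the thresholds eps_j = B 4^-j, the sum of the s_N^p is bounded in
terms of sum_j eps_j^p N(eps_(j+1)) ([summable_of_thresholds]), hence by a
multiple of sum_n b_n^(1/2) sum_(eps_j <= 4 b_n) eps_j^(p - 1/2).  Because
p > 1/2, the inner sum is geometric and dominated by its largest term, and a
multiple of sum_n b_n^p remains ([weighted_counts_le]).  All estimates concern
the numbers s_N themselves, so the failure of the triangle inequality in S_p for
p < 1 causes no difficulty. *)

(** * Tonelli's theorem on the half-line *)

Section Tonelli.
Variable R : realType.
Local Notation mu := (@lebesgue_measure R).
Local Notation TR := (measurableTypeR R).
Local Notation H := (@halfline R).

Lemma measurable_halfline : measurable H.
Proof. exact: measurable_itv. Qed.
Hint Resolve measurable_halfline : core.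

Local Open Scope ereal_scope.

Lemma measurable_halfline_section (F : TR * TR -> \bar R) :
  measurable_fun setT F -> (forall z, 0 <= F z) ->
  measurable_fun setT (fun x => \int[mu]_(y in H) F (x, y)).
Proof.
move=> mF F0.
under eq_fun do rewrite integral_mkcond.
pose G (z : TR * TR) := F z * (\1_H z.2)%:E.
have mG : measurable_fun setT G.
  apply: emeasurable_funM => //; apply/measurable_EFinP.
  by apply: measurableT_comp => //; exact: measurable_indic.
have G0 z : 0 <= G z by rewrite mule_ge0// lee_fin.
have -> : (fun x => \int[mu]_y ((fun y0 => F (x, y0)) \_ H) y) =
          (fun x => \int[mu]_y G (x, y)).
  apply/funext => x; apply: eq_integral => y _.
  by rewrite patchE /G /= indicE; case: ifPn; rewrite ?mule1 ?mule0.
have h := @measurable_fun_fubini_tonelli_F _ _ TR TR R mu G mG G0.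
exact h.
Qed.

Lemma tonelli_halfline (F : TR * TR -> \bar R) :
  measurable_fun setT F -> (forall z, 0 <= F z) ->
  \int[mu]_(x in H) \int[mu]_(y in H) F (x, y) =
  \int[mu]_(y in H) \int[mu]_(x in H) F (x, y).
Proof.
move=> mF F0.
pose G (z : TR * TR) := F z * (\1_H z.1)%:E * (\1_H z.2)%:E.
have mG : measurable_fun setT G.
  apply: emeasurable_funM; [apply: emeasurable_funM => //|];
    apply/measurable_EFinP.
  - by apply: measurableT_comp => //; exact: measurable_indic.
  - by apply: measurableT_comp => //; exact: measurable_indic.
have G0 z : 0 <= G z by rewrite !mule_ge0// lee_fin.
have := @fubini_tonelli _ _ TR TR R mu mu G mG G0.
rewrite /fubini_F /fubini_G.
congr (_ = _).
- rewrite [RHS]integral_mkcond; apply: eq_integral => x _.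
  rewrite patchE; case: ifPn => xH.
    rewrite [RHS]integral_mkcond; apply: eq_integral => y _.
    by rewrite patchE /G /= !indicE xH mule1; case: ifPn; rewrite ?mule1 ?mule0.
  rewrite integral0_eq// => y _.
  by rewrite /G /= indicE (negbTE xH) mule0 mul0e.
- rewrite [RHS]integral_mkcond; apply: eq_integral => y _.
  rewrite patchE; case: ifPn => yH.
    rewrite [RHS]integral_mkcond; apply: eq_integral => x _.
    by rewrite patchE /G /= !indicE yH mule1; case: ifPn; rewrite ?mule1 ?mule0.
  rewrite integral0_eq// => x _.
  by rewrite /G /= !indicE (negbTE yH) mule0.
Qed.

End Tonelli.

#[local] Hint Extern 0 (measurable _) => exact (@measurable_halfline _) : core.

(** * Schur's test *)

Section SchurTest.
Variable R : realType.
Local Notation mu := (@lebesgue_measure R).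
Local Notation TR := (measurableTypeR R).
Local Notation H := (@halfline R).

(** Optimizing over t the inequality between arithmetic and geometric means
gives the Cauchy-Schwarz inequality; in this form I may be infinite. *)
Lemma ge0_sqr_le_of_amgm (alpha : R) (I B : \bar R) :
  0 < alpha -> (0 <= I)%E -> (0 <= B)%E ->
  (forall t : R, 0 < t -> (I <= (t / 2 * alpha)%:E + ((2 * t)^-1)%:E * B)%E) ->
  (I * I <= alpha%:E * B)%E.
Proof.
move=> a0 I0; case: B => [b| |//]; last first.
  by move=> _ _; rewrite mulry gtr0_sg// mul1e leey.
rewrite lee_fin => b0 h.
have Ifin : I \is a fin_num.
  rewrite ge0_fin_numE//; apply: le_lt_trans (h 1 ltr01) _.
  by rewrite -EFinM -EFinD ltry.
rewrite -(fineK Ifin) in I0 h *; set r := fine I in I0 h *.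
rewrite -!EFinM !lee_fin in I0 *.
have [->|rn0] := eqVneq r 0; first by rewrite mulr0 mulr_ge0// ltW.
have r0 : 0 < r by rewrite lt_neqAle eq_sym rn0.
have := h (r / alpha) (divr_gt0 r0 a0).
rewrite -EFinM -EFinD lee_fin.
have -> : r / alpha / 2 * alpha + (2 * (r / alpha))^-1 * b
          = r / 2 + alpha * b / (2 * r).
  by field; rewrite !gt_eqF.
rewrite -(ler_pM2l (x := 2 * r)); last by rewrite mulr_gt0.
have -> : 2 * r * (r / 2 + alpha * b / (2 * r)) = r * r + alpha * b.
  by field; rewrite gt_eqF.
lra.
Qed.

(** Writing s a = (s w)^(1/2) (s a^2 / w)^(1/2), the Cauchy-Schwarz inequality
in y and the bound on the rows give one factor K; Tonelli's theorem and the
bound on the columns give the other.  The function v is the inverse of the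
weight w. *)
Lemma schur_test (s : TR * TR -> R) (a w v : TR -> R) (K : R) :
  0 < K ->
  measurable_fun setT s -> (forall z, 0 <= s z) ->
  measurable_fun setT a -> measurable_fun setT w -> measurable_fun setT v ->
  (forall y, H y -> 0 < w y) ->
  (forall y, 0 <= v y) ->
  (forall y, H y -> w y * v y = 1) ->
  (forall x, H x -> \int[mu]_(y in H) (s (x, y) * w y)%:E <= (K * w x)%:E)%E ->
  (forall y, H y -> \int[mu]_(x in H) (s (x, y) * w x)%:E <= (K * w y)%:E)%E ->
  (\int[mu]_(x in H)
     ((\int[mu]_(y in H) (s (x, y) * `|a y|)%:E) *
      (\int[mu]_(y in H) (s (x, y) * `|a y|)%:E)) <=
   (K ^+ 2)%:E * \int[mu]_(y in H) (a y ^+ 2)%:E)%E.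
Proof.
move=> K0 ms s0 ma mw mv w0 v0 wv hx hy.
have msnd (h : TR -> R) : measurable_fun setT h ->
    measurable_fun setT (fun z : TR * TR => h z.2).
  by move=> mh; apply: measurableT_comp => //; exact: measurable_snd.
pose F1 (z : TR * TR) := (s z * `|a z.2|)%:E.
pose F2 (z : TR * TR) := (s z * (a z.2 ^+ 2 * v z.2))%:E.
have mF1 : measurable_fun setT F1.
  apply/measurable_EFinP; apply: measurable_funM => //.
  by apply: (msnd (fun y => `|a y|)); exact: measurableT_comp.
have mF2 : measurable_fun setT F2.
  apply/measurable_EFinP; apply: measurable_funM => //.
  apply: (msnd (fun y => a y ^+ 2 * v y)); apply: measurable_funM => //.
  exact: measurable_funX.
have F10 z : (0 <= F1 z)%E by rewrite lee_fin mulr_ge0.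
have F20 z : (0 <= F2 z)%E.
  by rewrite lee_fin mulr_ge0// mulr_ge0// sqr_ge0.
have m1 (F : TR * TR -> \bar R) x : measurable_fun setT F ->
    measurable_fun H (fun y : TR => F (x, y)).
  move=> mF; apply: measurable_funTS.
  exact: (@measurable_fun_pair2 _ _ _ TR TR _ F x mF).
have m2 (F : TR * TR -> \bar R) y : measurable_fun setT F ->
    measurable_fun H (fun x : TR => F (x, y)).
  move=> mF; apply: measurable_funTS.
  exact: (@measurable_fun_pair1 _ _ _ TR TR _ F y mF).
have pw x : H x -> ((\int[mu]_(y in H) F1 (x, y)) * (\int[mu]_(y in H) F1 (x, y))
     <= (K * w x)%:E * \int[mu]_(y in H) F2 (x, y))%E.
  move=> Hx; apply: ge0_sqr_le_of_amgm.
  - by rewrite mulr_gt0// w0.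
  - exact: integral_ge0.
  - exact: integral_ge0.
  move=> t t0.
  pose G y := ((t / 2)%:E * (s (x, y) * w y)%:E + ((2 * t)^-1)%:E * F2 (x, y))%E.
  have mF3 : measurable_fun setT (fun z : TR * TR => (s z * w z.2)%:E).
    by apply/measurable_EFinP; apply: measurable_funM => //; exact: msnd.
  have mG1 : measurable_fun H (fun y : TR => ((t / 2)%:E * (s (x, y) * w y)%:E)%E).
    by apply: emeasurable_funM => //; exact (m1 _ x mF3).
  have mG2 : measurable_fun H (fun y : TR => (((2 * t)^-1)%:E * F2 (x, y))%E).
    by apply: emeasurable_funM => //; exact (m1 _ x mF2).
  have G10 (y : TR) : H y -> (0 <= (t / 2)%:E * (s (x, y) * w y)%:E)%E.
    move=> Hy; rewrite -EFinM lee_fin !mulr_ge0//.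
    - exact: ltW.
    - exact/ltW/w0.
  have G20 (y : TR) : H y -> (0 <= ((2 * t)^-1)%:E * F2 (x, y))%E.
    by move=> Hy; rewrite mule_ge0// lee_fin invr_ge0 mulr_ge0// ltW.
  apply: (@le_trans _ _ (\int[mu]_(y in H) G y)%E).
    apply: ge0_le_integral => //.
    - exact (m1 _ x mF1).
    - by apply: emeasurable_funD.
    - move=> y Hy; rewrite /G /F1 /F2 -!EFinM -EFinD lee_fin /=.
      rewrite [leRHS](_ : _ = s (x, y) * (t / 2 * w y
         + (2 * t)^-1 * (a y ^+ 2 * v y))); last by ring.
      apply: ler_wpM2l => //.
      have wy := w0 _ Hy; have e := wv _ Hy.
      have wn0 : w y != 0 by rewrite gt_eqF.
      have -> : v y = (w y)^-1 by apply: (mulfI wn0); rewrite e mulfV.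
      have -> : a y ^+ 2 = `|a y| ^+ 2 by rewrite real_normK// num_real.
      set b := `|a y|.
      rewrite -subr_ge0.
      have -> : t / 2 * w y + (2 * t)^-1 * (b ^+ 2 / w y) - b =
                (t * w y - b) ^+ 2 * (2 * t * w y)^-1.
        by field; rewrite !gt_eqF.
      by rewrite mulr_ge0 ?sqr_ge0// invr_ge0 ltW// !mulr_gt0.
  rewrite /G ge0_integralD//.
  apply: leeD.
    rewrite ge0_integralZl_EFin//.
    - rewrite [X in (_ <= X)%E]EFinM; apply: lee_wpmul2l; last exact: hx.
      by rewrite lee_fin divr_ge0// ltW.
    - by move=> y Hy; rewrite lee_fin mulr_ge0// ltW// w0.
    - exact (m1 _ x mF3).
    - by rewrite divr_ge0// ltW.
  rewrite ge0_integralZl_EFin//.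
  - exact (m1 _ x mF2).
  - by rewrite invr_ge0 mulr_ge0// ltW.
have mI1 := measurable_halfline_section mF1 F10.
have mI2 := measurable_halfline_section mF2 F20.
apply: (@le_trans _ _ (\int[mu]_(x in H) ((K * w x)%:E * \int[mu]_(y in H) F2 (x,
  y)))%E).
  apply: ge0_le_integral => //.
  - by move=> x Hx; apply: mule_ge0; apply: integral_ge0 => y _; exact: F10.
  - by apply: measurable_funTS; apply: emeasurable_funM.
  - apply: measurable_funTS; apply: emeasurable_funM => //.
    by apply/measurable_EFinP; apply: measurable_funM.
(* The weight is made nonnegative off the half-line as well, since Tonelli's
   theorem is applied to an integrand on the whole plane. *)
pose w0' x := (Num.max (w x) 0)%R.
pose F5 (z : TR * TR) := ((K * w0' z.1)%:E * F2 z)%E.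
have mw0' : measurable_fun setT w0'.
  by rewrite /w0'; apply: measurable_maxr.
have F50 z : (0 <= F5 z)%E.
  by rewrite mule_ge0// lee_fin mulr_ge0 ?le_max ?lexx ?orbT// ltW.
have mF5 : measurable_fun setT F5.
  apply: emeasurable_funM => //; apply/measurable_EFinP.
  apply: measurable_funM => //.
  by apply: measurableT_comp => //; exact: measurable_fst.
have w0'E x : H x -> w0' x = w x by move=> Hx; apply/max_idPl/ltW/w0.
have -> : (\int[mu]_(x in H) ((K * w x)%:E * \int[mu]_(y in H) F2 (x, y)) =
           \int[mu]_(x in H) \int[mu]_(y in H) F5 (x, y))%E.
  apply: eq_integral => x /set_mem Hx.
  rewrite /F5 /= w0'E// ge0_integralZl_EFin//; first exact (m1 _ x mF2).
  by rewrite mulr_ge0// ltW// w0.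
rewrite (tonelli_halfline mF5 F50).
rewrite -ge0_integralZl_EFin//; last 3 first.
- by move=> y _; rewrite lee_fin sqr_ge0.
- apply: measurable_funTS; apply/measurable_EFinP; exact: measurable_funX.
- by rewrite sqr_ge0.
apply: ge0_le_integral => //.
- by move=> y _; exact: integral_ge0.
- apply: measurable_funTS.
  have := measurable_halfline_section (F := fun z : TR * TR => F5 (z.2, z.1)).
  apply => //.
  apply: (measurableT_comp mF5); apply/measurable_fun_pairP; split => /=.
  + exact: measurable_snd.
  + exact: measurable_fst.
- apply: measurable_funTS; apply/measurable_EFinP; apply: measurable_funM => //.
  exact: measurable_funX.
move=> y Hy.
have wy := w0 _ Hy; have e := wv _ Hy.
have -> : (\int[mu]_(x in H) F5 (x, y) =
   \int[mu]_(x in H) ((K * (a y ^+ 2 * v y))%:E * (s (x, y) * w x)%:E))%E.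
  apply: eq_integral => x /set_mem Hx.
  by rewrite /F5 /F2 /= w0'E// -!EFinM; congr (_%:E); ring.
have mF6 : measurable_fun setT (fun z : TR * TR => (s z * w z.1)%:E).
  apply/measurable_EFinP; apply: measurable_funM => //.
  by apply: measurableT_comp => //; exact: measurable_fst.
rewrite ge0_integralZl_EFin//.
- apply: (@le_trans _ _ ((K * (a y ^+ 2 * v y))%:E * (K * w y)%:E)%E).
    apply: lee_wpmul2l; last exact: hy.
    by rewrite lee_fin mulr_ge0 ?(ltW K0)// mulr_ge0 ?sqr_ge0.
  rewrite -!EFinM lee_fin.
  have -> : K * (a y ^+ 2 * v y) * (K * w y) = K ^+ 2 * a y ^+ 2 * (w y * v y).
    by ring.
  by rewrite e mulr1.
- by move=> x Hx; rewrite lee_fin mulr_ge0// ltW// w0.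
- exact (m2 _ y mF6).
- by rewrite mulr_ge0 ?(ltW K0)// mulr_ge0 ?sqr_ge0.
Qed.

End SchurTest.

(** * Complex-valued functions on the half-line *)

Section ComplexFunctions.
Variable R : realType.
Local Notation C := (R[i])%type.
Local Notation mu := (@lebesgue_measure R).
Local Notation TR := (measurableTypeR R).
Local Notation H := (@halfline R).

Lemma complex_ReD (a b : C) : complex.Re (a + b) = complex.Re a + complex.Re b.
Proof. by case: a; case: b. Qed.
Lemma complex_ImD (a b : C) : complex.Im (a + b) = complex.Im a + complex.Im b.
Proof. by case: a; case: b. Qed.
Lemma complex_ReM (a b : C) :
  complex.Re (a * b) = complex.Re a * complex.Re b - complex.Im a * complex.Im b.
Proof. by case: a; case: b. Qed.
Lemma complex_ImM (a b : C) :
  complex.Im (a * b) = complex.Re a * complex.Im b + complex.Im a * complex.Re b.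
Proof. by case: a; case: b. Qed.

Lemma cabs_sqr (z : C) : cabs z ^+ 2 = complex.Re z ^+ 2 + complex.Im z ^+ 2.
Proof. by case: z => a b; rewrite /cabs /= sqr_sqrtr// addr_ge0// sqr_ge0. Qed.

Lemma cabs_ge0 (z : C) : 0 <= cabs z.
Proof. by case: z => a b; exact: sqrtr_ge0. Qed.
Lemma cabs_lee0 (z : C) : (0 <= (cabs z)%:E)%E.
Proof. by rewrite lee_fin cabs_ge0. Qed.
Hint Resolve cabs_ge0 cabs_lee0 : core.

Lemma Re_le_cabs (z : C) : `|complex.Re z| <= cabs z.
Proof.
rewrite -(@ler_pXn2r _ 2)// ?nnegrE ?normr_ge0//.
by rewrite cabs_sqr real_normK ?num_real// lerDl sqr_ge0.
Qed.

Lemma Im_le_cabs (z : C) : `|complex.Im z| <= cabs z.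
Proof.
rewrite -(@ler_pXn2r _ 2)// ?nnegrE ?normr_ge0//.
by rewrite cabs_sqr real_normK ?num_real// lerDr sqr_ge0.
Qed.

Lemma cabs_leD (z : C) : cabs z <= `|complex.Re z| + `|complex.Im z|.
Proof.
rewrite -(@ler_pXn2r _ 2)// ?nnegrE ?addr_ge0//.
rewrite cabs_sqr sqrrD -[in leLHS](@real_normK _ (complex.Re z)) ?num_real//.
rewrite -[in leLHS](@real_normK _ (complex.Im z)) ?num_real//.
by rewrite [leRHS]addrAC lerDl mulrn_wge0// mulr_ge0.
Qed.

Lemma cabsM (a b : C) : cabs (a * b) = cabs a * cabs b.
Proof. exact: ComplexField.Normc.normcM. Qed.

Lemma cabsD (a b : C) : cabs (a + b) <= cabs a + cabs b.
Proof. exact: le_normcD. Qed.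

Lemma cabs0 : cabs (0 : C) = 0.
Proof. exact: ComplexField.Normc.normc0. Qed.

Lemma cabsN (a : C) : cabs (- a) = cabs a.
Proof. exact: normcN. Qed.

Lemma cmeasurableD (f g : R -> C) : cmeasurable f -> cmeasurable g ->
  cmeasurable (fun x => f x + g x).
Proof.
move=> [f1 f2] [g1 g2]; split.
- by under eq_fun do rewrite complex_ReD; exact: measurable_funD.
- by under eq_fun do rewrite complex_ImD; exact: measurable_funD.
Qed.

Lemma cmeasurableM (f g : R -> C) : cmeasurable f -> cmeasurable g ->
  cmeasurable (fun x => f x * g x).
Proof.
move=> [f1 f2] [g1 g2]; split.
- under eq_fun do rewrite complex_ReM; apply: measurable_funB;
    exact: measurable_funM.
- under eq_fun do rewrite complex_ImM; apply: measurable_funD;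
    exact: measurable_funM.
Qed.

Lemma cmeasurable_cst (c : C) : cmeasurable (fun _ : R => c).
Proof. by split; exact: measurable_cst. Qed.

Lemma measurable_cabs d (T : measurableType d) (D : set T) (f : T -> C) :
  measurable_fun D (fun x => complex.Re (f x)) ->
  measurable_fun D (fun x => complex.Im (f x)) ->
  measurable_fun D (fun x => cabs (f x)).
Proof.
move=> m1 m2.
have -> : (fun x => cabs (f x)) =
    (fun x => (complex.Re (f x) ^+ 2 + complex.Im (f x) ^+ 2) `^ 2^-1).
  by apply/funext => x; rewrite powR12_sqrt ?addr_ge0 ?sqr_ge0// /cabs; case: (f x).
have m : measurable_fun D (fun x => complex.Re (f x) ^+ 2 + complex.Im (f x) ^+ 2).
  by apply: measurable_funD; exact: measurable_funX.
exact: (measurableT_comp (@measurable_powR R 2^-1) m).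
Qed.

Lemma cmeasurable_cabs (f : R -> C) : cmeasurable f ->
  measurable_fun H (fun x => cabs (f x)).
Proof. by case; exact: measurable_cabs. Qed.

Lemma emeasurable_cabs (f : R -> C) : cmeasurable f ->
  measurable_fun H (fun x => (cabs (f x))%:E).
Proof. by move=> mf; apply/measurable_EFinP; exact: cmeasurable_cabs. Qed.

Definition cintegrable (F : R -> C) :=
  cmeasurable F /\ (\int[mu]_(x in H) (cabs (F x))%:E < +oo)%E.

Lemma cintegrable_Re (F : R -> C) : cintegrable F ->
  mu.-integrable H (EFin \o (fun x => complex.Re (F x))).
Proof.
move=> [[mF1 mF2] iF]; apply/integrableP; split; first exact/measurable_EFinP.
apply: le_lt_trans iF; apply: ge0_le_integral => //.
- apply: measurableT_comp => //; exact/measurable_EFinP.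
- exact: emeasurable_cabs.
- by move=> x _ /=; rewrite lee_fin Re_le_cabs.
Qed.

Lemma cintegrable_Im (F : R -> C) : cintegrable F ->
  mu.-integrable H (EFin \o (fun x => complex.Im (F x))).
Proof.
move=> [[mF1 mF2] iF]; apply/integrableP; split; first exact/measurable_EFinP.
apply: le_lt_trans iF; apply: ge0_le_integral => //.
- apply: measurableT_comp => //; exact/measurable_EFinP.
- exact: emeasurable_cabs.
- by move=> x _ /=; rewrite lee_fin Im_le_cabs.
Qed.

Lemma cintegrableD (F G : R -> C) : cintegrable F -> cintegrable G ->
  cintegrable (fun x => F x + G x).
Proof.
move=> [mF iF] [mG iG]; split; first exact: cmeasurableD.
apply: (@le_lt_trans _ _ (\int[mu]_(x in H) ((cabs (F x))%:E + (cabs (G x))%:E))%E).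
  apply: ge0_le_integral => //.
  - by apply: emeasurable_cabs; exact: cmeasurableD.
  - by apply: emeasurable_funD; exact: emeasurable_cabs.
  - by move=> x _; rewrite lee_fin cabsD.
rewrite ge0_integralD//; last 2 first.
- exact: emeasurable_cabs.
- exact: emeasurable_cabs.
exact: lte_add_pinfty.
Qed.

Lemma cintegrableZ (a : C) (F : R -> C) : cintegrable F ->
  cintegrable (fun x => a * F x).
Proof.
move=> [mF iF]; split; first exact: cmeasurableM (cmeasurable_cst a) mF.
under eq_integral do rewrite cabsM EFinM.
rewrite ge0_integralZl_EFin//; last exact: emeasurable_cabs.
by rewrite lte_mul_pinfty.
Qed.

Lemma cintegralD (F G : R -> C) : cintegrable F -> cintegrable G ->
  cintegral (fun x => F x + G x) = cintegral F + cintegral G.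
Proof.
move=> iF iG; rewrite /cintegral.
rewrite -[RHS]/(Complex (_ + _) (_ + _)); congr Complex.
- rewrite -RintegralD//; [|exact: cintegrable_Re|exact: cintegrable_Re].
  by apply: eq_Rintegral => x _; rewrite complex_ReD.
- rewrite -RintegralD//; [|exact: cintegrable_Im|exact: cintegrable_Im].
  by apply: eq_Rintegral => x _; rewrite complex_ImD.
Qed.

Lemma cintegralZ (a : C) (F : R -> C) : cintegrable F ->
  cintegral (fun x => a * F x) = a * cintegral F.
Proof.
move=> iF; have i1 := cintegrable_Re iF; have i2 := cintegrable_Im iF.
have i1' b : mu.-integrable H (EFin \o (fun x => b * complex.Re (F x))).
  have mH : measurable (H : set TR) by [].
  have h := integrableZl mH b i1; exact h.
have i2' b : mu.-integrable H (EFin \o (fun x => b * complex.Im (F x))).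
  have mH : measurable (H : set TR) by [].
  have h := integrableZl mH b i2; exact h.
rewrite /cintegral; case: a => a b.
rewrite -[RHS]/(Complex (_ - _) (_ + _)); congr Complex.
- rewrite -!RintegralZl// -RintegralB//.
  by apply: eq_Rintegral => x _; rewrite complex_ReM.
- rewrite -!RintegralZl// -RintegralD//.
  by apply: eq_Rintegral => x _; rewrite complex_ImM.
Qed.

(** The factor 2 comes from estimating the real and imaginary parts separately.
*)
Lemma cintegral_sqr_le (F : R -> C) : cmeasurable F ->
  ((cabs (cintegral F) ^+ 2)%:E <=
   2%:E * (\int[mu]_(x in H) (cabs (F x))%:E * \int[mu]_(x in H)
     (cabs (F x))%:E))%E.
Proof.
move=> mF; set A := (\int[mu]_(x in H) (cabs (F x))%:E)%E.
have A0 : (0 <= A)%E by exact: integral_ge0.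
have [Aoo|] := eqVneq A +oo%E.
  by rewrite Aoo mulyy mulry gtr0_sg// mul1e leey.
rewrite -ltey => Afin.
have iF : cintegrable F by split.
have fA : A \is a fin_num by rewrite ge0_fin_numE.
have iA : mu.-integrable H (EFin \o (fun x => cabs (F x))).
  apply/integrableP; split; first exact: emeasurable_cabs.
  under eq_integral do rewrite /= ger0_norm//; exact: Afin.
have bnd (h : R -> R) : mu.-integrable H (EFin \o h) ->
    (forall x, `|h x| <= cabs (F x)) -> `|\int[mu]_(x in H) h x| <= fine A.
  move=> ih hle; apply: (le_trans (le_normr_Rintegral _ ih)) => //.
  apply: le_Rintegral => //.
  have := integrable_norm ih; exact.
rewrite -(fineK fA) -!EFinM lee_fin cabs_sqr /=.
rewrite -[X in X ^+ 2 + _]/(\int[mu]_(x in H) complex.Re (F x)).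
rewrite -[X in _ + X ^+ 2]/(\int[mu]_(x in H) complex.Im (F x)).
have b1 := bnd _ (cintegrable_Re iF) (fun x => Re_le_cabs (F x)).
have b2 := bnd _ (cintegrable_Im iF) (fun x => Im_le_cabs (F x)).
have sq (u : R) : `|u| <= fine A -> u ^+ 2 <= fine A * fine A.
  move=> uA; rewrite -(@real_normK _ u) ?num_real// expr2.
  by rewrite ler_pM.
by apply: (le_trans (lerD (sq _ b1) (sq _ b2))); rewrite mulr_natl mulr2n.
Qed.

End ComplexFunctions.

#[local] Hint Resolve cabs_ge0 cabs_lee0 : core.

(** * Integral operators with a Schur bound *)

Section IntegralOperators.
Variable R : realType.
Local Notation C := (R[i])%type.
Local Notation mu := (@lebesgue_measure R).
Local Notation TR := (measurableTypeR R).
Local Notation H := (@halfline R).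

Lemma halflineP (x : R) : H x <-> 0 < x.
Proof. by rewrite /halfline /= in_itv /= andbT. Qed.

Definition integral_operator (k : R -> R -> C) (f : R -> C) : R -> C :=
  fun x => cintegral (fun y => k x y * f y).

(** An exponent strictly between -1 and 0 is what Hardy's kernel 1 / max(x, y)
requires: the weight is integrable at 0, and so is its quotient by the variable
at infinity. *)
Definition schur_weight (y : R) : R := y `^ (- 2^-1).

Lemma schur_weight_gt0 y : H y -> 0 < schur_weight y.
Proof. by move=> /halflineP; exact: powR_gt0. Qed.

Definition kmeasurable (k : R -> R -> C) : Prop :=
  measurable_fun setT (fun z : TR * TR => complex.Re (k z.1 z.2)) /\
  measurable_fun setT (fun z : TR * TR => complex.Im (k z.1 z.2)).

Definition schur_bounded (K : R) (k : R -> R -> C) : Prop :=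
  [/\ 0 < K, kmeasurable k,
   (forall x, H x ->
     \int[mu]_(y in H) (cabs (k x y)
       * schur_weight y)%:E <= (K * schur_weight x)%:E)%E &
   (forall y, H y ->
     \int[mu]_(x in H) (cabs (k x y)
       * schur_weight x)%:E <= (K * schur_weight y)%:E)%E].

Definition l2sq (f : R -> C) : \bar R := (\int[mu]_(x in H) (cabs (f x) ^+ 2)%:E)%E.

Lemma l2sq_ge0 f : (0 <= l2sq f)%E.
Proof. by apply: integral_ge0 => x _; rewrite lee_fin sqr_ge0. Qed.

Lemma L2P f : L2 f <-> cmeasurable f /\ (l2sq f < +oo)%E.
Proof.
split=> -[mf hf]; split=> //.
- by apply: lty_poweRy hf; rewrite invr_eq0.
- exact: poweR_lty.
Qed.

Lemma l2norm_le (f g : R -> C) (K : R) : 0 <= K ->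
  (l2sq f <= (K ^+ 2)%:E * l2sq g)%E -> (l2norm f <= K%:E * l2norm g)%E.
Proof.
move=> K0 h; rewrite /l2norm -/(l2sq f) -/(l2sq g).
have -> : K%:E = poweR (K ^+ 2)%:E 2^-1.
  by rewrite poweR_EFin powR12_sqrt ?sqr_ge0// sqrtr_sqr ger0_norm.
rewrite -poweRM ?l2sq_ge0 ?lee_fin ?sqr_ge0//.
apply: gt0_ler_poweR => //; rewrite in_itv /= leey andbT.
- exact: l2sq_ge0.
- by rewrite mule_ge0 ?l2sq_ge0 ?lee_fin ?sqr_ge0.
Qed.

(** Extension by zero, which turns measurability on the half-line into
measurability on the line, as needed for the product measure. *)
Definition crestrict (f : R -> C) (x : R) : C :=
  Complex (((fun x => complex.Re (f x)) \_ H) x)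
          (((fun x => complex.Im (f x)) \_ H) x).

Lemma crestrictE f x : H x -> crestrict f x = f x.
Proof.
by move=> Hx; rewrite /crestrict !patchE mem_set//; case: (f x).
Qed.

Lemma measurable_Re_crestrict f : cmeasurable f ->
  measurable_fun setT (fun x : TR => complex.Re (crestrict f x)).
Proof. by case=> m1 m2; apply/(measurable_restrictT _ _).1. Qed.

Lemma measurable_Im_crestrict f : cmeasurable f ->
  measurable_fun setT (fun x : TR => complex.Im (crestrict f x)).
Proof. by case=> m1 m2; apply/(measurable_restrictT _ _).1. Qed.

Lemma measurable_cabs_crestrict f : cmeasurable f ->
  measurable_fun setT (fun x : TR => cabs (crestrict f x)).
Proof.
move=> mf; apply: (@measurable_cabs _ _ TR).
- exact: measurable_Re_crestrict.
- exact: measurable_Im_crestrict.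
Qed.

Lemma measurable_Rintegral_section (F : TR * TR -> R) :
  measurable_fun setT F ->
  measurable_fun H (fun x : R => \int[mu]_(y in H) F (x, y)).
Proof.
move=> mF; apply: (@measurable_funTS _ _ TR); rewrite /Rintegral.
have mFE : measurable_fun setT (fun z => (F z)%:E) by exact/measurable_EFinP.
pose Fp := (fun z => (F z)%:E)^\+%E.
pose Fn := (fun z => (F z)%:E)^\-%E.
have mp : measurable_fun setT Fp by exact: measurable_funepos.
have mn : measurable_fun setT Fn by exact: measurable_funeneg.
have p0 z : (0 <= Fp z)%E by exact: funepos_ge0.
have n0 z : (0 <= Fn z)%E by exact: funeneg_ge0.
have hp := measurable_halfline_section mp p0.
have hn := measurable_halfline_section mn n0.
have -> : (fun x : TR => fine (\int[mu]_(y in H) (F (x, y))%:E)) =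
  fine \o (fun x => (\int[mu]_(y in H) Fp (x, y) - \int[mu]_(y in H) Fn (x, y))%E).
  apply/funext => x /=; rewrite integralE; congr (fine (_ - _)%E);
    by apply: eq_integral => y _; rewrite /Fp /Fn ?funeposE ?funenegE.
apply: measurableT_comp => //.
exact: emeasurable_funB.
Qed.

Lemma measurable_kernel_section k x : kmeasurable k -> cmeasurable (k x).
Proof.
case=> m1 m2; split; apply: (@measurable_funTS _ _ TR).
- exact (@measurable_fun_pair2 _ _ _ TR TR _ _ x m1).
- exact (@measurable_fun_pair2 _ _ _ TR TR _ _ x m2).
Qed.

Lemma intop_crestrict k f : integral_operator k (crestrict f)
  = integral_operator k f.
Proof.
apply/funext => x; rewrite /integral_operator /cintegral; congr Complex;
  by apply: eq_Rintegral => y /set_mem Hy; rewrite crestrictE.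
Qed.

Lemma cmeasurable_integral_operator k f : kmeasurable k -> cmeasurable f ->
  cmeasurable (integral_operator k f).
Proof.
move=> [m1 m2] mf; rewrite -intop_crestrict.
have f1 := measurable_Re_crestrict mf; have f2 := measurable_Im_crestrict mf.
have s1 : measurable_fun setT (fun z : TR * TR => complex.Re (crestrict f z.2)).
  exact: (measurableT_comp f1 (@measurable_snd _ _ TR TR)).
have s2 : measurable_fun setT (fun z : TR * TR => complex.Im (crestrict f z.2)).
  exact: (measurableT_comp f2 (@measurable_snd _ _ TR TR)).
split.
- have mF : measurable_fun setT
    (fun z : TR * TR => complex.Re (k z.1 z.2 * crestrict f z.2)).
    rewrite [X in measurable_fun _ X](_ : _ = fun z : TR * TR =>
      complex.Re (k z.1 z.2) * complex.Re (crestrict f z.2) -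
        complex.Im (k z.1 z.2) * complex.Im (crestrict f z.2)).
      by apply: measurable_funB; exact: measurable_funM.
    by apply/funext => z; exact: complex_ReM.
  exact: (measurable_Rintegral_section mF).
- have mF : measurable_fun setT
    (fun z : TR * TR => complex.Im (k z.1 z.2 * crestrict f z.2)).
    rewrite [X in measurable_fun _ X](_ : _ = fun z : TR * TR =>
      complex.Re (k z.1 z.2) * complex.Im (crestrict f z.2) +
        complex.Im (k z.1 z.2) * complex.Re (crestrict f z.2)).
      by apply: measurable_funD; exact: measurable_funM.
    by apply/funext => z; exact: complex_ImM.
  exact: (measurable_Rintegral_section mF).
Qed.

(** This majorant takes values in the extended reals; where it is finite, the
operator is given by an absolutely convergent integral. *)
Definition abs_integral (k : R -> R -> C) (f : R -> C) (x : R) : \bar R :=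
  (\int[mu]_(y in H) (cabs (k x y * f y))%:E)%E.

Lemma abs_integral_ge0 k f x : (0 <= abs_integral k f x)%E.
Proof. exact: integral_ge0. Qed.

Lemma measurable_kcabs k : kmeasurable k ->
  measurable_fun setT (fun z : TR * TR => cabs (k z.1 z.2)).
Proof. by case=> m1 m2; exact: measurable_cabs. Qed.

Lemma abs_integralE k f x : abs_integral k f x =
  (\int[mu]_(y in H) (cabs (k x y) * `|cabs (crestrict f y)|)%:E)%E.
Proof.
apply: eq_integral => y /set_mem Hy; rewrite crestrictE//.
by rewrite cabsM ger0_norm// cabs_ge0.
Qed.

Lemma measurable_abs_integral k f : kmeasurable k -> cmeasurable f ->
  measurable_fun H (abs_integral k f).
Proof.
move=> mk mf; apply: (@measurable_funTS _ _ TR).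
have -> : abs_integral k f = (fun x => \int[mu]_(y in H)
    (cabs (k x y) * `|cabs (crestrict f y)|)%:E)%E.
  by apply/funext => x; exact: abs_integralE.
have mF : measurable_fun setT
   (fun z : TR * TR => (cabs (k z.1 z.2) * `|cabs (crestrict f z.2)|)%:E).
  apply/measurable_EFinP; apply: measurable_funM; first exact: measurable_kcabs.
  apply: measurableT_comp => //.
  exact: (measurableT_comp (measurable_cabs_crestrict mf)
    (@measurable_snd _ _ TR TR)).
apply: (measurable_halfline_section mF) => z.
by rewrite lee_fin mulr_ge0// cabs_ge0.
Qed.

Lemma abs_integral_sqr_le K k f : schur_bounded K k -> cmeasurable f ->
  (\int[mu]_(x in H) (abs_integral k f x * abs_integral k f x)
    <= (K ^+ 2)%:E * l2sq f)%E.
Proof.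
move=> [K0 mk hx hy] mf.
have -> : l2sq f = (\int[mu]_(x in H) (cabs (crestrict f x) ^+ 2)%:E)%E.
  by apply: eq_integral => y /set_mem Hy; rewrite crestrictE.
have -> : (\int[mu]_(x in H) (abs_integral k f x * abs_integral k f x) =
  \int[mu]_(x in H)
     ((\int[mu]_(y in H) (cabs (k x y) * `|cabs (crestrict f y)|)%:E) *
      (\int[mu]_(y in H) (cabs (k x y) * `|cabs (crestrict f y)|)%:E)))%E.
  by apply: eq_integral => x _; rewrite abs_integralE.
apply: (@schur_test R (fun z => cabs (k z.1 z.2)) (fun y => cabs (crestrict f y))
   schur_weight (fun y => y `^ 2^-1) K) => //.
- exact: measurable_kcabs.
- exact: measurable_cabs_crestrict.
- exact: measurable_powR.
- exact: schur_weight_gt0.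
- by move=> y; exact: powR_ge0.
- move=> y /halflineP y0; rewrite /schur_weight powRN mulVf// gt_eqF//.
  exact: powR_gt0.
Qed.

Lemma l2sq_integral_operator_le K k f : schur_bounded K k -> cmeasurable f ->
  (l2sq (integral_operator k f) <= ((2 * K) ^+ 2)%:E * l2sq f)%E.
Proof.
move=> sk mf; have [K0 mk _ _] := sk.
apply: (@le_trans _ _ (\int[mu]_(x in H)
  (2%:E * (abs_integral k f x * abs_integral k f x))))%E.
  apply: ge0_le_integral => //.
  - by move=> x _; rewrite lee_fin sqr_ge0.
  - apply/measurable_EFinP; apply: measurable_funX; apply: cmeasurable_cabs.
    exact: cmeasurable_integral_operator.
  - apply: emeasurable_funM => //.
    by apply: emeasurable_funM; exact: measurable_abs_integral.
  - move=> x Hx; apply: cintegral_sqr_le; apply: cmeasurableM => //.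
    exact: measurable_kernel_section.
rewrite ge0_integralZl_EFin//; last 2 first.
- by move=> x _; rewrite mule_ge0 ?abs_integral_ge0.
- by apply: emeasurable_funM; exact: measurable_abs_integral.
apply: (@le_trans _ _ (2%:E * ((K ^+ 2)%:E * l2sq f)))%E.
  by apply: lee_wpmul2l => //; exact: abs_integral_sqr_le.
rewrite muleA -EFinM; apply: lee_wpmul2r; first exact: l2sq_ge0.
rewrite lee_fin exprMn ler_wpM2r ?sqr_ge0//; lra.
Qed.

Lemma L2_integral_operator K k f : schur_bounded K k -> L2 f ->
  L2 (integral_operator k f).
Proof.
move=> sk /L2P[mf f2]; apply/L2P; split.
  by apply: cmeasurable_integral_operator => //; case: sk.
apply: (le_lt_trans (l2sq_integral_operator_le sk mf)).
by rewrite lte_mul_pinfty// lee_fin sqr_ge0.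
Qed.

Lemma l2norm_integral_operator_le K k f : schur_bounded K k -> cmeasurable f ->
  (l2norm (integral_operator k f) <= (2 * K)%:E * l2norm f)%E.
Proof.
move=> sk mf; apply: l2norm_le; last exact: l2sq_integral_operator_le.
by case: sk => K0 _ _ _; rewrite mulr_ge0// ltW.
Qed.

(** The square of the majorant has a finite integral, so the integrals defining
the operator converge absolutely for almost every x, though possibly not for
all. *)
Lemma ae_cintegrable_integral_operator K k f : schur_bounded K k -> L2 f ->
  {ae mu, forall x, H x -> cintegrable (fun y => k x y * f y)}.
Proof.
move=> sk /L2P[mf f2]; have [K0 mk _ _] := sk.
have iA : mu.-integrable H (fun x => abs_integral k f x * abs_integral k f x)%E.
  apply/integrableP; split.
    by apply: emeasurable_funM; exact: measurable_abs_integral.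
  under eq_integral do rewrite gee0_abs ?mule_ge0 ?abs_integral_ge0//.
  apply: (le_lt_trans (abs_integral_sqr_le sk mf)).
  by rewrite lte_mul_pinfty// lee_fin sqr_ge0.
have := integrable_ae _ iA; move/(_ (@measurable_halfline R)).
apply: filterS => x h Hx; split.
  by apply: cmeasurableM => //; exact: measurable_kernel_section.
rewrite -/(abs_integral k f x) ltey; apply/eqP => e.
by have := h Hx; rewrite e mulyy.
Qed.

End IntegralOperators.

(** * Finite rank approximation of integral operators *)

Section FiniteRank.
Variable R : realType.
Local Notation C := (R[i])%type.
Local Notation mu := (@lebesgue_measure R).
Local Notation H := (@halfline R).

Lemma eq_cintegral (F G : R -> C) : (forall y, H y -> F y = G y) ->
  cintegral F = cintegral G.
Proof.
by move=> FG; rewrite /cintegral; congr Complex;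
  apply: eq_Rintegral => y /set_mem Hy; rewrite FG.
Qed.

Lemma eq_cmeasurable (F G : R -> C) : (forall y, H y -> F y = G y) ->
  cmeasurable F -> cmeasurable G.
Proof.
move=> FG [m1 m2]; split.
- by apply: (eq_measurable_fun (fun x => complex.Re (F x))) => // x /set_mem /FG ->.
- by apply: (eq_measurable_fun (fun x => complex.Im (F x))) => // x /set_mem /FG ->.
Qed.

Lemma eq_cintegrable (F G : R -> C) : (forall y, H y -> F y = G y) ->
  cintegrable F -> cintegrable G.
Proof.
move=> FG [mF iF]; split; first exact: eq_cmeasurable mF.
rewrite (_ : integral _ _ _ = (\int[mu]_(x in H) (cabs (F x))%:E)%E)//.
by apply: eq_integral => y /set_mem /FG ->.
Qed.

Lemma cintegrable0 : cintegrable (fun=> 0 : C).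
Proof.
split; first exact: cmeasurable_cst.
by rewrite integral0_eq ?ltry// => x _; rewrite cabs0.
Qed.

Lemma cintegral0 : cintegral (fun=> 0 : C) = 0.
Proof.
have := cintegralZ 0 cintegrable0; rewrite [RHS]mul0r => h; rewrite -[RHS]h.
by apply: eq_cintegral => y _; rewrite mul0r.
Qed.

Lemma cintegral_sum (I : eqType) (s : seq I) (F : I -> R -> C) :
  (forall i, i \in s -> cintegrable (F i)) ->
  cintegrable (fun y => \sum_(i <- s) F i y) /\
  cintegral (fun y => \sum_(i <- s) F i y) = \sum_(i <- s) cintegral (F i).
Proof.
elim: s => [|i s IH] h.
  split.
    by apply: eq_cintegrable cintegrable0 => y _; rewrite big_nil.
  by rewrite big_nil -[RHS]cintegral0; apply: eq_cintegral => y _; rewrite big_nil.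
have hi : cintegrable (F i) by apply: h; rewrite mem_head.
have [|IH1 IH2] := IH; first by move=> j js; apply: h; rewrite in_cons js orbT.
split.
  apply: eq_cintegrable (cintegrableD hi IH1) => y _; by rewrite big_cons.
rewrite big_cons -IH2 -cintegralD//.
by apply: eq_cintegral => y _; rewrite big_cons.
Qed.

Lemma cintegrable_L2M (u f : R -> C) : L2 u -> L2 f ->
  cintegrable (fun y => u y * f y).
Proof.
move=> /L2P[mu2 u2] /L2P[mf f2]; split; first exact: cmeasurableM.
have msq (g : R -> C) : cmeasurable g ->
  measurable_fun H (fun x => (cabs (g x) ^+ 2)%:E).
  by move=> mg; apply/measurable_EFinP; apply: measurable_funX;
    exact: cmeasurable_cabs.
apply: (@le_lt_trans _ _
  (\int[mu]_(x in H) ((cabs (u x) ^+ 2)%:E + (cabs (f x) ^+ 2)%:E))%E).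
  apply: ge0_le_integral => //.
  - by apply: emeasurable_cabs; exact: cmeasurableM.
  - by apply: emeasurable_funD; exact: msq.
  - move=> x _; rewrite -EFinD lee_fin cabsM.
    have := sqr_ge0 (cabs (u x) - cabs (f x)); have := cabs_ge0 (u x).
    have := cabs_ge0 (f x); nra.
rewrite ge0_integralD//; last 4 first.
- by move=> x _; rewrite lee_fin sqr_ge0.
- exact: msq.
- by move=> x _; rewrite lee_fin sqr_ge0.
- exact: msq.
exact: lte_add_pinfty.
Qed.

Lemma L2_0 : L2 (fun=> 0 : C).
Proof.
apply/L2P; split; first exact: cmeasurable_cst.
by rewrite /l2sq integral0_eq ?ltry// => x _; rewrite cabs0 expr0n.
Qed.

Definition tensor_sum (s : seq ((R -> C) * (R -> C))) (x y : R) : C :=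
  \sum_(p <- s) p.1 x * p.2 y.

(** Each tensor u(x) v(y) sends f to a multiple of u.  Positions beyond the end
of the list are filled with the zero function, which allows any n not less than
its length. *)
Lemma rank_le_tensor_sum (s : seq ((R -> C) * (R -> C))) (k : R -> R -> C) n :
  (forall p, p \in s -> L2 p.1 /\ L2 p.2) ->
  (forall x y, H x -> H y -> k x y = tensor_sum s x y) ->
  (size s <= n)%N -> rank_le n (integral_operator k).
Proof.
move=> sL2 kE sn; pose d : (R -> C) * (R -> C) := (fun=> 0, fun=> 0).
have nthL2 i : L2 (nth d s i).1 /\ L2 (nth d s i).2.
  have [lt|ge] := ltnP i (size s); first by apply: sL2; exact: mem_nth.
  by rewrite nth_default//; split; exact: L2_0.
exists (fun i : 'I_n => (nth d s i).1); split => [i|f Lf]; first by case: (nthL2 i).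
exists (fun i : 'I_n => cintegral (fun y => (nth d s i).2 y * f y)).
apply: aeW => x Hx.
have -> : integral_operator k f x =
    cintegral (fun y => \sum_(p <- s) p.1 x * (p.2 y * f y)).
  apply: eq_cintegral => y Hy; rewrite kE// /tensor_sum mulr_suml.
  by apply: eq_bigr => p _; rewrite mulrA.
have hint p : p \in s -> cintegrable (fun y => p.2 y * f y).
  by move=> /sL2[_ L]; exact: cintegrable_L2M.
have [_ ->] := @cintegral_sum _ s (fun p y => p.1 x * (p.2 y * f y))
  (fun p ps => cintegrableZ _ (hint p ps)).
rewrite (eq_big_seq (fun p => cintegral (fun y => p.2 y * f y) * p.1 x));
  last first.
  by move=> p ps; rewrite [LHS](cintegralZ (p.1 x) (hint p ps)); exact: mulrC.
rewrite (big_nth d) big_mkord.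
rewrite (big_ord_widen n (fun i => cintegral (fun y =>
  (nth d s i).2 y * f y) * (nth d s i).1 x))//.
rewrite big_mkcond /=; apply: eq_bigr => i _; case: ifPn => //.
by rewrite -leqNgt => h; rewrite nth_default// mulr0.
Qed.

Lemma ae_integral_operator_lin K k (a : C) f g : schur_bounded K k -> L2 f ->
  L2 g ->
  ae_eq mu H (integral_operator k (fun x => a * f x + g x))
             (fun x => a * integral_operator k f x + integral_operator k g x).
Proof.
move=> sk Lf Lg.
have hf := ae_cintegrable_integral_operator sk Lf;
  have hg := ae_cintegrable_integral_operator sk Lg.
move: hf hg; apply: filterS2; first exact: (ae_filter_ringOfSetsType mu).
move=> x hf hg Hx.
have {}hf := hf Hx; have {}hg := hg Hx.
rewrite /integral_operator -cintegralZ// -cintegralD//; last exact: cintegrableZ.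
by apply: eq_cintegral => y _; rewrite mulrDr; congr (_ + _); rewrite mulrCA.
Qed.

Lemma bounded_operator_integral_operator K k : schur_bounded K k ->
  @bounded_operator R (integral_operator k).
Proof.
move=> sk; split.
- by move=> f; exact: L2_integral_operator sk.
- by move=> a f g; exact: ae_integral_operator_lin sk.
- exists (2 * K) => f /L2P[mf _]; exact: l2norm_integral_operator_le.
Qed.

Lemma ae_integral_operatorB K K' k k' f : schur_bounded K k ->
  schur_bounded K' k' -> L2 f ->
  ae_eq mu H (fun x => integral_operator k f x - integral_operator k' f x)
             (integral_operator (fun x y => k x y - k' x y) f).
Proof.
move=> sk sk' Lf.
have hf := ae_cintegrable_integral_operator sk Lf;
  have hg := ae_cintegrable_integral_operator sk' Lf.
move: hf hg; apply: filterS2; first exact: (ae_filter_ringOfSetsType mu).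
move=> x hf hg Hx.
have {}hf := hf Hx; have {}hg := hg Hx.
rewrite /integral_operator -[- cintegral _]mulN1r -cintegralZ// -cintegralD//;
  last exact: cintegrableZ.
by apply: eq_cintegral => y _; rewrite mulN1r mulrBl.
Qed.

Lemma ae_eq_l2norm f g : cmeasurable f -> cmeasurable g -> ae_eq mu H f g ->
  l2norm f = l2norm g.
Proof.
move=> mf mg fg; congr (poweR _ _); apply: ae_eq_integral => //.
- by apply/measurable_EFinP; apply: measurable_funX; exact: cmeasurable_cabs.
- by apply/measurable_EFinP; apply: measurable_funX; exact: cmeasurable_cabs.
- by apply: filterS fg => x /[apply] ->.
Qed.

(** The operator with kernel k' competes in the infimum, and the factor 2
absorbs the loss in [cintegral_sqr_le]. *)
Lemma singular_number_integral_operator_le (s : seq ((R -> C) * (R ->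
  C))) (K K' e : R)
    (k k' : R -> R -> C) n :
  schur_bounded K k -> schur_bounded K' k' ->
  schur_bounded e (fun x y => k x y - k' x y) ->
  (forall p, p \in s -> L2 p.1 /\ L2 p.2) ->
  (forall x y, H x -> H y -> k' x y = tensor_sum s x y) ->
  (size s <= n)%N ->
  (singular_number n (integral_operator k) <= (2 * e)%:E)%E.
Proof.
move=> sk sk' se sL2 k'E sn.
apply: (@le_trans _ _ (opnorm (fun f x =>
  integral_operator k f x - integral_operator k' f x))).
  apply: ereal_inf_lbound; exists (integral_operator k') => //; split.
    exact: bounded_operator_integral_operator sk'.
  exact: rank_le_tensor_sum sL2 k'E sn.
apply: ge_ereal_sup => _ [f [Lf f1] <-].
have [mf f2] := (L2P f).1 Lf.
have m1 : cmeasurable (integral_operator k f)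
  by apply: cmeasurable_integral_operator => //; case: sk.
have m2 : cmeasurable (integral_operator k' f)
  by apply: cmeasurable_integral_operator => //; case: sk'.
have m3 : cmeasurable (integral_operator (fun x y => k x y - k' x y) f).
  by apply: cmeasurable_integral_operator => //; case: se.
have e0 : 0 < e by case: se.
rewrite (@ae_eq_l2norm _ (integral_operator (fun x y => k x y - k' x y) f))//;
  last 2 first.
- have := cmeasurableD m1 (cmeasurableM (cmeasurable_cst (-1)) m2).
  by apply: eq_cmeasurable => x _; rewrite mulN1r.
- exact: ae_integral_operatorB sk sk' Lf.
apply: (le_trans (l2norm_integral_operator_le se mf)).
rewrite -[leRHS]mule1; apply: lee_wpmul2l => //.
by rewrite lee_fin mulr_ge0// ltW.
Qed.

Lemma singular_number_ge0 n (T : (R -> C) -> (R -> C)) :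
  (0 <= singular_number n T)%E.
Proof.
apply: le_ereal_inf_tmp => _ [K _ <-].
apply: (@le_trans _ _ (l2norm (fun x => T (fun=> 0) x - K (fun=> 0) x))).
  exact: poweR_ge0.
apply: ereal_sup_ubound; exists (fun=> 0) => //; split; first exact: L2_0.
rewrite /l2norm integral0_eq ?poweR0r ?invr_eq0// => x _.
by rewrite cabs0 expr0n.
Qed.

End FiniteRank.

(** * Kernels concentrated near the diagonal *)

Section HardyWeight.
Variable R : realType.
Local Notation C := (R[i])%type.
Local Notation mu := (@lebesgue_measure R).
Local Notation TR := (measurableTypeR R).
Local Notation H := (@halfline R).

Lemma is_derive_cst_powR (c r y : R) : 0 < y ->
  is_derive y (1 : R) (fun y : R => c * y `^ r) (c * r * y `^ (r - 1)).
Proof.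
move=> y0; have h := is_derive1_powR r y0.
by rewrite -mulrA; exact: is_deriveZ.
Qed.

Lemma integral_powR (a b c r : R) : 0 < a -> a < b ->
  (\int[mu]_(y in `[a, b]) (c * r * y `^ (r - 1))%:E =
   (c * b `^ r - c * a `^ r)%:E)%E.
Proof.
move=> a0 ab; rewrite EFinB.
have cF (y : R) : 0 < y -> {for y, continuous (fun y : R => c * y `^ r)}.
  move=> y0; apply/differentiable_continuous/derivable1_diffP.
  by have [] := is_derive_cst_powR c r y0.
apply: (continuous_FTC2 (F := fun y : R => c * y `^ r)) => //.
- apply: derivable_within_continuous => y; rewrite in_itv/= => /andP[ay _].
  by have [] := is_derive_cst_powR (c * r) (r - 1) (lt_le_trans a0 ay).
- split.
  + move=> y; rewrite in_itv /= => /andP[ay _].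
    by have [] := is_derive_cst_powR c r (lt_trans a0 ay).
  + by apply: cvg_at_right_filter; exact: cF.
  + by apply: cvg_at_left_filter; apply: cF; exact: lt_trans ab.
- move=> y; rewrite in_itv /= => /andP[ay _]; rewrite derive1E.
  by have [_] := is_derive_cst_powR c r (lt_trans a0 ay).
Qed.

Lemma schur_weight_double (x y : R) : 0 < x -> 0 < y -> x <= 4 * y ->
  schur_weight y <= 2 * schur_weight x.
Proof.
move=> x0 y0 xy; rewrite /schur_weight !powRN (powR12_sqrt (ltW x0))
  (powR12_sqrt (ltW y0)).
have sx : 0 < Num.sqrt x by rewrite sqrtr_gt0.
have sy : 0 < Num.sqrt y by rewrite sqrtr_gt0.
have h : Num.sqrt x <= 2 * Num.sqrt y.
  rewrite -(@ler_pXn2r _ 2) ?nnegrE ?mulr_ge0 ?sqrtr_ge0//.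
  by rewrite exprMn (sqr_sqrtr (ltW x0)) (sqr_sqrtr (ltW y0)) -natrX.
by rewrite -[leLHS]mul1r ler_pdivrMr// mulrAC ler_pdivlMr// mul1r.
Qed.

(** On [a, x] the integrand is y^(-1/2) / x and on [x, b] it is y^(-3/2); either
part is at most 2 x^(-1/2), uniformly in a and b. *)
Lemma hardy_weight_segment (a b x : R) : 0 < a -> a < x -> x < b ->
  (\int[mu]_(y in `[a, b]) (Num.max x y `^ (-1) * schur_weight y)%:E
     <= (4 * schur_weight x)%:E)%E.
Proof.
move=> a0 ax xb; have x0 := lt_trans a0 ax.
have mf : measurable_fun (setT : set R)
    (fun y : R => (Num.max x y `^ (-1) * schur_weight y)%:E).
  apply/measurable_EFinP; apply: measurable_funM; last exact: measurable_powR.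
  have m : measurable_fun (setT : set R) (fun y : R => Num.max x y).
    by apply: measurable_maxr.
  exact: (measurableT_comp (@measurable_powR R (-1)) m).
have f0 (y : R) : (0 <= (Num.max x y `^ (-1) * schur_weight y)%:E)%E.
  by rewrite lee_fin mulr_ge0 ?powR_ge0.
have -> : `[a, b]%classic = `[a, x]%classic `|` `]x, b]%classic.
  by apply/seteqP; split => y /=; rewrite !in_itv /=; lra.
rewrite ge0_integral_setU//=; last 2 first.
- exact: measurable_funTS.
- by apply/disj_setPS => y /=; rewrite !in_itv /=; lra.
have -> : 4 * schur_weight x = 2 * schur_weight x + 2 * schur_weight x by ring.
rewrite EFinD; apply: leeD.
- have -> : (\int[mu]_(y in `[a, x]) (Num.max x y `^ (-1) * schur_weight y)%:E =
     \int[mu]_(y in `[a, x]) ((x `^ (-1) * 2) * 2^-1 * y `^ (2^-1 - 1))%:E)%E.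
    apply: eq_integral => y /set_mem /=; rewrite in_itv /= => /andP[ay yx].
    rewrite max_l// mulfK ?pnatr_eq0// /schur_weight.
    by rewrite (_ : 2^-1 - 1 = - 2^-1 :> R)//; field.
  rewrite integral_powR// lee_fin.
  apply: (@le_trans _ _ (x `^ (-1) * 2 * x `^ 2^-1)).
    by rewrite gerBl !mulr_ge0 ?powR_ge0.
  rewrite mulrAC -powRD ?(gt_eqF x0) ?implybT// mulrC /schur_weight.
  by rewrite (_ : -1 + 2^-1 = - 2^-1 :> R)//; field.
- apply: (@le_trans _ _ (\int[mu]_(y in `[x,
    b]) (Num.max x y `^ (-1) * schur_weight y)%:E)%E).
    apply: ge0_subset_integral => //; first exact: measurable_funTS.
    by apply: subset_itvr; rewrite bnd_simp.
  have -> : (\int[mu]_(y in `[x, b]) (Num.max x y `^ (-1) * schur_weight y)%:E =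
     \int[mu]_(y in `[x, b]) ((-2) * (- 2^-1) * y `^ (- 2^-1 - 1))%:E)%E.
    apply: eq_integral => y /set_mem /=; rewrite in_itv /= => /andP[xy yb].
    have y0 : 0 < y by exact: lt_le_trans xy.
    rewrite max_r// mulrNN mulfV// mul1r /schur_weight.
    by rewrite -powRD ?(gt_eqF y0) ?implybT// addrC.
  rewrite integral_powR// lee_fin /schur_weight.
  by have := powR_ge0 b (- 2^-1); lra.
Qed.

Lemma halfline_bigcup :
  H = \bigcup_n `[(n.+1%:R : R)^-1, n.+1%:R]%classic.
Proof.
apply/seteqP; split => y /=.
  move=> /halflineP y0.
  have [n hn] : exists n, y <= n.+1%:R /\ y^-1 <= n.+1%:R.
    exists (Num.truncn (Num.max y y^-1)).
    by split; apply/ltW; apply: le_lt_trans (truncnS_gt _);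
      rewrite le_max lexx ?orbT.
  exists n => //=; rewrite in_itv /= (proj1 hn) andbT.
  by rewrite -[leRHS]invrK lef_pV2 ?posrE ?invr_gt0//; exact: (proj2 hn).
by move=> [n _ /=]; rewrite in_itv /= => /andP[h _]; apply/halflineP;
  apply: lt_le_trans h.
Qed.

(** The segments [1/n, n] exhaust the half-line and the bound on them is
uniform. *)
Lemma hardy_weight (x : R) : 0 < x ->
  (\int[mu]_(y in H) (Num.max x y `^ (-1)
    * schur_weight y)%:E <= (4 * schur_weight x)%:E)%E.
Proof.
move=> x0.
have mf : measurable_fun (setT : set R)
    (fun y : R => (Num.max x y `^ (-1) * schur_weight y)%:E).
  apply/measurable_EFinP; apply: measurable_funM; last exact: measurable_powR.
  have m : measurable_fun (setT : set R) (fun y : R => Num.max x y).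
    by apply: measurable_maxr.
  exact: (measurableT_comp (@measurable_powR R (-1)) m).
have f0 (y : R) : (0 <= (Num.max x y `^ (-1) * schur_weight y)%:E)%E.
  by rewrite lee_fin mulr_ge0 ?powR_ge0.
rewrite halfline_bigcup.
pose F : nat -> set TR := fun n => `[(n.+1%:R : R)^-1, n.+1%:R]%classic.
have ndF : nondecreasing_seq F.
  move=> m n mn; apply/subsetPset; apply: subset_itvScc; rewrite bnd_simp.
    by rewrite lef_pV2 ?posrE// ler_nat.
  by rewrite ler_nat.
have cvgF := @ge0_nondecreasing_set_cvg_integral _ TR R F
  (fun y : R => (Num.max x y `^ (-1) * schur_weight y)%:E) mu ndF
  (fun n => measurable_itv _) (fun n => measurable_funTS mf) (fun n y _ => f0 y).
rewrite -(cvg_lim _ cvgF)//; apply: lime_le.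
  by apply/cvg_ex; eexists; exact: cvgF.
near=> n; apply: hardy_weight_segment.
- by rewrite invr_gt0.
- rewrite -[ltRHS]invrK ltf_pV2 ?posrE ?invr_gt0//.
  near: n; apply: filterS (nbhs_infty_gtr x^-1) => n h.
  by apply: lt_trans h _; rewrite ltr_nat.
- near: n; apply: filterS (nbhs_infty_gtr x) => n h.
  by apply: lt_trans h _; rewrite ltr_nat.
Unshelve. all: by end_near. Qed.
(** As a function of y, rho is Hardy's kernel plus a bump of height D within
distance q of x, which contributes D * q to Schur's test; on the bump, x <= 4 *
y keeps the weights at x and y comparable. *)
Definition near_diag_bound (e d : R) (rho : R -> R) (x : R) : Prop :=
  exists D q : R, [/\ 0 <= D, 0 <= q, D * q <= d &
    forall y, H y -> rho y <= e * Num.max x y `^ (-1) +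
      (if (`|x - y| <= q) && (x <= 4 * y) then D else 0)].

Lemma near_diag_bound_integral (e d : R) (rho : R -> R) (x : R) :
  0 <= e -> H x -> measurable_fun H rho -> (forall y, 0 <= rho y) ->
  near_diag_bound e d rho x ->
  (\int[mu]_(y in H) (rho y * schur_weight y)%:E <= (4 * (e + d)
    * schur_weight x)%:E)%E.
Proof.
move=> e0 Hx mrho rho0 [D [q [D0 q0 Dq hrho]]].
have x0 : 0 < x by apply/halflineP.
pose I : set TR := `[x - q, x + q]%classic.
have mI : measurable I by exact: measurable_itv.
have mh : measurable_fun (setT : set TR)
    (fun y : TR => (Num.max x y `^ (-1) * schur_weight y)%:E).
  apply/measurable_EFinP; apply: measurable_funM; last exact: measurable_powR.
  have m : measurable_fun (setT : set R) (fun y : R => Num.max x y).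
    by apply: measurable_maxr.
  exact: (measurableT_comp (@measurable_powR R (-1)) m).
have mi : measurable_fun (setT : set TR) (fun y : TR => (\1_I y)%:E : \bar R).
  by apply/measurable_EFinP; exact: measurable_indic.
have h0 (y : R) : (0 <= (Num.max x y `^ (-1) * schur_weight y)%:E)%E.
  by rewrite lee_fin mulr_ge0 ?powR_ge0.
have sx0 : 0 < schur_weight x by exact: schur_weight_gt0.
have c0 : 0 <= D * (2 * schur_weight x) by rewrite mulr_ge0// mulr_ge0// ltW.
apply: (@le_trans _ _ (\int[mu]_(y in H)
   (e%:E * (Num.max x y `^ (-1) * schur_weight y)%:E +
    (D * (2 * schur_weight x))%:E * (\1_I y)%:E))%E).
  apply: ge0_le_integral => //.
  - by move=> y Hy; rewrite lee_fin mulr_ge0 ?powR_ge0.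
  - apply/measurable_EFinP; apply: measurable_funM => //.
    exact: measurable_funTS (@measurable_powR R _).
  - apply: (@measurable_funTS _ _ TR); apply: emeasurable_funD;
      exact: emeasurable_funM.
  - move=> y Hy; rewrite -!EFinM -EFinD lee_fin.
    have y0 : 0 < y by apply/halflineP.
    have sy0 : 0 < schur_weight y by exact: schur_weight_gt0.
    apply: (le_trans (ler_wpM2r (ltW sy0) (hrho y Hy))).
    rewrite mulrDl -[e * _ * _]mulrA lerD2l; case: ifPn => [/andP[xyq xy]|_];
      last first.
      by rewrite mul0r mulr_ge0.
    rewrite indicE mem_set ?mulr1.
      by apply: ler_wpM2l => //; exact: schur_weight_double.
    by rewrite /I /= in_itv /=; move: xyq; rewrite ler_norml; lra.
rewrite ge0_integralD//; last 4 first.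
- by move=> y Hy; rewrite mule_ge0.
- by apply: (@measurable_funTS _ _ TR); exact: emeasurable_funM.
- by move=> y Hy; rewrite mule_ge0// lee_fin.
- by apply: (@measurable_funTS _ _ TR); exact: emeasurable_funM.
rewrite ge0_integralZl_EFin//; last exact: measurable_funTS.
rewrite ge0_integralZl_EFin//; last exact: measurable_funTS.
have i1 : (\int[mu]_(y in H) (\1_I y)%:E <= (2 * q)%:E)%E.
  rewrite integral_indic//.
  apply: (@le_trans _ _ (mu I)).
    by apply: le_measure; rewrite ?inE//; exact: measurableI.
  rewrite lebesgue_measure_itv /= lte_fin; case: ifPn => _.
    by rewrite -EFinB lee_fin; lra.
  by rewrite lee_fin mulr_ge0.
have -> : 4 * (e + d) * schur_weight x = e * (4 * schur_weight x)
  + 4 * d * schur_weight x by ring.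
rewrite EFinD; apply: leeD.
  by rewrite EFinM; apply: lee_wpmul2l; rewrite ?lee_fin//; exact: hardy_weight.
apply: (@le_trans _ _ ((D * (2 * schur_weight x))%:E * (2 * q)%:E)%E).
  by apply: lee_wpmul2l; rewrite ?lee_fin.
rewrite -EFinM lee_fin.
have -> : D * (2 * schur_weight x) * (2 * q) = 4 * (D * q) * schur_weight x by ring.
by rewrite ler_pM2r// ler_pM2l.
Qed.

Lemma schur_bounded_near_diag (e d : R) (k : R -> R -> C) :
  0 < e -> 0 <= d -> kmeasurable k ->
  (forall x, H x -> near_diag_bound e d (fun y => cabs (k x y)) x) ->
  (forall y, H y -> near_diag_bound e d (fun x => cabs (k x y)) y) ->
  schur_bounded (4 * (e + d)) k.
Proof.
move=> e0 d0 mk hx hy; split => //.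
- by rewrite mulr_gt0// ltr_wpDr.
- move=> x Hx; apply: near_diag_bound_integral => //; rewrite ?ltW//.
    by apply: cmeasurable_cabs; exact: measurable_kernel_section.
  exact: hx.
- move=> y Hy; apply: (near_diag_bound_integral (rho := fun x =>
    cabs (k x y))) => //.
  + exact: ltW.
  + apply: (@measurable_funTS _ _ TR).
    exact (@measurable_fun_pair1 _ _ _ TR TR _ _ y (measurable_kcabs mk)).
  + exact: hy.
Qed.

End HardyWeight.

(** * Finite rank kernels defined by a labelling *)

Section LabelKernels.
Variable R : realType.
Local Notation C := (R[i])%type.
Local Notation mu := (@lebesgue_measure R).
Local Notation TR := (measurableTypeR R).
Local Notation H := (@halfline R).

Lemma nondecreasing_measurable_halfline (f : R -> R) :
  (forall x y, 0 < x -> x <= y -> f x <= f y) -> measurable_fun H f.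
Proof.
move=> nd mH.
apply: (measurability (@RGenCInfty.G R)) mH => [|/= _ [_] [r] -> <-].
  exact: RGenCInfty.measurableE.
apply: is_interval_measurable =>
  x y [/halflineP x0 hx] [/halflineP y0 hy] z /andP[xz zy].
move: hx hy; rewrite /= !in_itv /= !andbT => hx hy.
have z0 : 0 < z by exact: lt_le_trans xz.
split; first by apply/halflineP.
by rewrite /= ?in_itv /= ?andbT (le_trans hx)// nd.
Qed.

Lemma bounded_support_L2 (f : R -> C) (T M : R) : cmeasurable f ->
  (forall x, H x -> cabs (f x) <= M) ->
  (forall x, H x -> T < x -> f x = 0) -> L2 f.
Proof.
move=> mf fM f0; apply/L2P; split => //.
have M0 x : H x -> cabs (f x) ^+ 2 <= M ^+ 2.
  move=> Hx; rewrite ler_pXn2r ?nnegrE//; first exact: fM.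
  exact: cabs_ge0.
  exact: (le_trans (cabs_ge0 (f x)) (fM _ Hx)).
pose I : set TR := `[0, Num.max T 0]%classic.
have mI : measurable I by exact: measurable_itv.
apply: (@le_lt_trans _ _ (\int[mu]_(x in H) ((M ^+ 2)%:E * (\1_I x)%:E))%E).
  apply: ge0_le_integral => //.
  - by move=> x _; rewrite lee_fin sqr_ge0.
  - apply/measurable_EFinP; apply: measurable_funX; exact: cmeasurable_cabs.
  - apply: emeasurable_funM => //; apply/measurable_EFinP.
    by apply: (@measurable_funTS _ _ TR); exact: measurable_indic.
  - move=> x Hx; rewrite -EFinM lee_fin.
    have [xT|Tx] := leP x T; last first.
      by rewrite f0// cabs0 expr0n /= mulr_ge0 ?sqr_ge0.
    rewrite indicE mem_set ?mulr1; first exact: M0.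
    by move/halflineP : Hx => x0; rewrite /I /= in_itv /= ltW//= le_max xT.
rewrite ge0_integralZl_EFin ?sqr_ge0//; last first.
  by apply/measurable_EFinP; apply: (@measurable_funTS _ _ TR);
    exact: measurable_indic.
rewrite lte_mul_pinfty ?lee_fin ?sqr_ge0//.
rewrite integral_indic//; apply: (@le_lt_trans _ _ (mu I)).
  by apply: le_measure; rewrite ?inE//; exact: measurableI.
by rewrite lebesgue_measure_itv /= lte_fin; case: ifPn => _;
  rewrite ?ltry// -EFinB ltry.
Qed.

Definition label_part (Phi : R -> C) (ell : R -> R) (L : seq R) (x : R) : C :=
  if ell x \in L then Phi x else 0.

(** For an increasing ell this is Phi at the larger argument as soon as the
labels of x and y differ, up to the truncation to labels in L. *)
Definition label_kernel (Phi : R -> C) (ell : R -> R) (L : seq R) (x y : R) : C :=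
  if ell y <= ell x then label_part Phi ell L x else label_part Phi ell L y.

(** Each label contributes a row block and a column block of the kernel; one of
the two comparisons is strict so that the diagonal block is counted once. *)
Definition label_tensors (Phi : R -> C) (ell : R -> R) (L : seq R) :
    seq ((R -> C) * (R -> C)) :=
  [seq ((fun x => if ell x == t then Phi x else 0),
        (fun y => if ell y <= t then 1 else 0)) | t <- L] ++
  [seq ((fun x => if ell x < t then 1 else 0),
        (fun y => if ell y == t then Phi y else 0)) | t <- L].

Lemma size_label_tensors Phi ell L : size (label_tensors Phi ell L)
  = (2 * size L)%N.
Proof. by rewrite size_cat !size_map mul2n addnn. Qed.

Lemma sum_pick (L : seq R) (u : R) (c : C) : uniq L ->
  \sum_(t <- L) (if u == t then c else 0) = if u \in L then c else 0.
Proof.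
elim: L => [|t L IH] /=; first by rewrite big_nil.
move=> /andP[tL uL]; rewrite big_cons IH// in_cons.
case: eqVneq => [->|_] /=; last by rewrite add0r.
by rewrite (negbTE tL) addr0.
Qed.

Lemma label_kernelE Phi ell L x y : uniq L ->
  label_kernel Phi ell L x y = tensor_sum (label_tensors Phi ell L) x y.
Proof.
move=> uL; rewrite /tensor_sum big_cat /= !big_map /=.
rewrite (eq_bigr (fun t =>
  if ell x == t then (if ell y <= ell x then Phi x else 0) else 0)); last first.
  move=> t _; case: eqVneq => [->|_]; last by rewrite mul0r.
  by case: ifP => _; rewrite ?mulr1 ?mulr0.
rewrite [X in _ + X](eq_bigr (fun t =>
  if ell y == t then (if ell x < ell y then Phi y else 0) else 0)); last first.
  move=> t _; case: eqVneq => [->|_]; last by rewrite mulr0.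
  by case: ifP => _; rewrite ?mul1r ?mul0r.
rewrite !sum_pick// /label_kernel /label_part ltNge.
by case: (ell y <= ell x) => /=; case: ifP; case: ifP; rewrite ?addr0 ?add0r.
Qed.

Lemma measurable_label_part d (T : measurableType d) (Phi ell : T ->
  R) (L : seq R) :
  measurable_fun setT Phi -> measurable_fun setT ell ->
  measurable_fun setT (fun x => if ell x \in L then Phi x else 0).
Proof.
move=> mPhi mell; apply: measurable_fun_ifT => //.
elim: L => [|t L IH]; first by rewrite (_ : (fun _ => _) = fun=> false).
rewrite (_ : (fun _ => _) = (fun x => (ell x == t) || (ell x \in L))).
  by apply: measurable_or => //; exact: measurable_fun_eqr.
by apply/funext => x; rewrite in_cons.
Qed.

Lemma Re_if (b : bool) (u v : C) :
  complex.Re (if b then u else v) = if b then complex.Re u else complex.Re v.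
Proof. by case: b. Qed.

Lemma Im_if (b : bool) (u v : C) :
  complex.Im (if b then u else v) = if b then complex.Im u else complex.Im v.
Proof. by case: b. Qed.

Lemma kmeasurable_label_kernel (Phi : R -> C) (ell : R -> R) (L : seq R) :
  measurable_fun (setT : set TR) (fun x : TR => complex.Re (Phi x)) ->
  measurable_fun (setT : set TR) (fun x : TR => complex.Im (Phi x)) ->
  measurable_fun (setT : set TR) (ell : TR -> R) ->
  kmeasurable (label_kernel Phi ell L).
Proof.
move=> m1 m2 mell.
have fst' (f : TR -> R) : measurable_fun setT f ->
    measurable_fun setT (fun z : TR * TR => f z.1).
  by move=> mf; exact: (measurableT_comp mf (@measurable_fst _ _ TR TR)).
have snd' (f : TR -> R) : measurable_fun setT f ->
    measurable_fun setT (fun z : TR * TR => f z.2).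
  by move=> mf; exact: (measurableT_comp mf (@measurable_snd _ _ TR TR)).
have mb : measurable_fun setT (fun z : TR * TR => ell z.2 <= ell z.1).
  by apply: measurable_fun_ler; [exact: snd'|exact: fst'].
have h (f : TR -> R) : measurable_fun setT f ->
    measurable_fun setT (fun z : TR * TR => if ell z.2 <= ell z.1
      then (if ell z.1 \in L then f z.1 else 0)
        else (if ell z.2 \in L then f z.2 else 0)).
  move=> mf; apply: measurable_fun_ifT => //.
  - exact: (fst' _ (measurable_label_part L mf mell)).
  - exact: (snd' _ (measurable_label_part L mf mell)).
have k1 := h _ m1; have k2 := h _ m2.
split.
- have -> // : (fun z : TR * TR => complex.Re (label_kernel Phi ell L z.1 z.2)) =
    (fun z : TR * TR => if ell z.2 <= ell z.1
      then (if ell z.1 \in L then complex.Re (Phi z.1) else 0)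
      else (if ell z.2 \in L then complex.Re (Phi z.2) else 0)).
  by apply/funext => z; rewrite /label_kernel /label_part !Re_if.
- have -> // : (fun z : TR * TR => complex.Im (label_kernel Phi ell L z.1 z.2)) =
    (fun z : TR * TR => if ell z.2 <= ell z.1
      then (if ell z.1 \in L then complex.Im (Phi z.1) else 0)
      else (if ell z.2 \in L then complex.Im (Phi z.2) else 0)).
  by apply/funext => z; rewrite /label_kernel /label_part !Im_if.
Qed.

(** Labels bounded above confine x to a bounded set; labels bounded below keep x
away from 0, where g, and hence Phi, may be unbounded. *)
Lemma label_tensors_L2 (Phi : R -> C) (ell g : R -> R) (L : seq R) :
  measurable_fun (setT : set TR) (fun x : TR => complex.Re (Phi x)) ->
  measurable_fun (setT : set TR) (fun x : TR => complex.Im (Phi x)) ->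
  measurable_fun (setT : set TR) (ell : TR -> R) ->
  (forall t, exists T, forall x, 0 < x -> ell x <= t -> x <= T) ->
  (forall t, exists2 c, 0 < c & forall x, 0 < x -> t <= ell x -> c <= x) ->
  (forall x, 0 < x -> cabs (Phi x) <= g x) ->
  (forall x y, 0 < x -> x <= y -> g y <= g x) ->
  forall p, p \in label_tensors Phi ell L -> L2 p.1 /\ L2 p.2.
Proof.
move=> m1 m2 mell up lo Phig gn.
have ind (b : R -> R -> bool) t (hb : forall u, b u t -> u <= t) :
    measurable_fun (setT : set TR) (fun x : TR => b (ell x) t) ->
    L2 (fun x => if b (ell x) t then 1 else 0).
  move=> mb; have [T hT] := up t; apply: (@bounded_support_L2 _ T 1).
  - split; apply: (@measurable_funTS _ _ TR).
    + rewrite [X in measurable_fun _ X](_ : _ = (fun x : TR =>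
        if b (ell x) t then 1 else 0)).
        exact: measurable_fun_ifT.
      by apply/funext => x; rewrite Re_if.
    + rewrite [X in measurable_fun _ X](_ : _ = (fun x : TR => 0)).
        exact: measurable_cst.
      by apply/funext => x; rewrite Im_if /=; case: ifP.
  - move=> x _; case: ifP => _; last by rewrite cabs0.
    by rewrite /cabs ComplexField.Normc.normc1.
  - move=> x /halflineP x0 Tx; case: ifP => // /hb /(hT _ x0).
    by rewrite leNgt Tx.
have eqL t : L2 (fun x => if ell x == t then Phi x else 0).
  have [T hT] := up t; have [c c0 hc] := lo t.
  have g0 x : 0 < x -> 0 <= g x.
    by move=> x0; exact: (le_trans (cabs_ge0 (Phi x)) (Phig _ x0)).
  apply: (@bounded_support_L2 _ T (g c)).
  - have mb : measurable_fun (setT : set TR) (fun x : TR => ell x == t).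
      by apply: measurable_fun_eqr.
    split; apply: (@measurable_funTS _ _ TR).
    + rewrite [X in measurable_fun _ X](_ : _ = (fun x : TR =>
        if ell x == t then complex.Re (Phi x) else 0)).
        exact: measurable_fun_ifT.
      by apply/funext => x; rewrite Re_if.
    + rewrite [X in measurable_fun _ X](_ : _ = (fun x : TR =>
        if ell x == t then complex.Im (Phi x) else 0)).
        exact: measurable_fun_ifT.
      by apply/funext => x; rewrite Im_if.
  - move=> x /halflineP x0; case: eqVneq => [e|_]; last by rewrite cabs0 g0.
    by apply: (le_trans (Phig _ x0)); apply: gn => //; apply: hc => //; rewrite e.
  - move=> x /halflineP x0 Tx; case: eqVneq => // e.
    by have := hT _ x0; rewrite e lexx leNgt Tx => /(_ isT).
move=> p; rewrite mem_cat => /orP[] /mapP[t tL ->] /=; split => //.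
- apply: (ind (fun u v => u <= v)) => //.
  exact: measurable_fun_ler.
- apply: (ind (fun u v => u < v)) => //; first by move=> u /ltW.
  exact: measurable_fun_ltr.
Qed.

End LabelKernels.

(** * The labelling adapted to a monotone function *)

Section DyadicLabels.
Variable R : realType.
Local Notation TR := (measurableTypeR R).
Local Notation H := (@halfline R).

Definition dyadic_index (x : R) : int := Num.floor (ln x / ln 2).

Lemma ln2_gt0 : 0 < ln (2 : R).
Proof. by rewrite ln_gt0// ltr1n. Qed.

Lemma pow2E (n : int) : (2 : R) ^ n = expR (n%:~R * ln 2).
Proof. by rewrite -powR_intmul// /powR pnatr_eq0. Qed.

Lemma pow2_gt0 (n : int) : 0 < (2 : R) ^ n.
Proof. exact: exprz_gt0. Qed.

Lemma pow2S (n : int) : (2 : R) ^ (n + 1) = 2 * 2 ^ n.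
Proof. by rewrite exprzDr ?unitfE ?pnatr_eq0// expr1z mulrC. Qed.

Lemma dyadic_index_le x : 0 < x -> 2 ^ dyadic_index x <= x.
Proof.
move=> x0; rewrite pow2E -[leRHS]lnK ?posrE// ler_expR.
by rewrite -ler_pdivlMr ?ln2_gt0// floor_le.
Qed.

Lemma dyadic_index_gt x : 0 < x -> x < 2 * 2 ^ dyadic_index x.
Proof.
move=> x0; rewrite -pow2S pow2E -[ltLHS]lnK ?posrE// ltr_expR.
by rewrite -ltr_pdivrMr ?ln2_gt0// floorD1_gt.
Qed.

Lemma dyadic_index_mono x y : 0 < x -> x <= y -> dyadic_index x <= dyadic_index y.
Proof.
move=> x0 xy; apply: le_floor; rewrite ler_pM2r ?invr_gt0 ?ln2_gt0//.
by rewrite ler_ln ?posrE// (lt_le_trans x0).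
Qed.

Section Labels.
Variables (g : R -> R) (eps : R).
Hypothesis g0 : forall x, 0 < x -> 0 <= g x.
Hypothesis gn : forall x y, 0 < x -> x <= y -> g y <= g x.
Hypothesis eps0 : 0 < eps.

(** A nonnegative nonincreasing g lies in X_p exactly when the p-th powers of
these numbers are summable. *)
Definition dyadic_mass (n : int) : R := 2 ^ n * g (2 ^ n).
(** Zero exactly when the dyadic mass is below eps, and otherwise such that the
mass divided by the square of the count is comparable to eps. *)
Definition cell_count (n : int)
  : nat := Num.truncn (Num.sqrt (dyadic_mass n / eps)).
(** Within a dyadic interval the position x and the value - g x both increase,
so this difference of floors is increasing and can be constant only where both
floors are: it numbers the cells of the common refinement of a partition by
length and a partition by the values of g. *)
Definition cell_index (n : int) (x : R) : int :=
  Num.floor (x * (cell_count n)%:R / 2 ^ n)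
    - Num.floor (g x * (cell_count n)%:R / g (2 ^ n)).
(** Adding to the dyadic index a fraction in [0, 1) makes the numbering of all
cells one increasing function.  Where the count is 0 the fraction is 0 because
division by 0 gives 0, and the whole dyadic interval is one cell. *)
Definition cell_label (x : R) : R :=
  let n := dyadic_index x in
  if 0 < x then n%:~R + (cell_index n x)%:~R / (2 * cell_count n)%:R else 0.

Lemma dyadic_mass_ge0 n : 0 <= dyadic_mass n.
Proof. by rewrite mulr_ge0 ?g0 ?ltW ?pow2_gt0. Qed.

Lemma cell_count_gt0 n : (0 < cell_count n)%N = (eps <= dyadic_mass n).
Proof.
have u0 : 0 <= dyadic_mass n / eps by apply: divr_ge0;
  [exact: dyadic_mass_ge0|exact: ltW].
rewrite /cell_count truncn_gt0 -(@ler_pXn2r _ 2) ?nnegrE ?sqrtr_ge0//.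
by rewrite expr1n (sqr_sqrtr u0) ler_pdivlMr// mul1r.
Qed.

Lemma cell_count_le n : (cell_count n)%:R <= Num.sqrt (dyadic_mass n / eps).
Proof. by rewrite truncn_le sqrtr_ge0. Qed.

Lemma dyadic_mass_div_le n : dyadic_mass n / (cell_count n)%:R ^+ 2 <= 4 * eps.
Proof.
have [->|m0] := posnP (cell_count n);
  first by rewrite expr0n /= invr0 mulr0 mulr_ge0// ltW.
have m0' : 0 < (cell_count n)%:R :> R by rewrite ltr0n.
rewrite ler_pdivrMr ?exprn_gt0// -mulrA mulrCA -ler_pdivrMl//.
have /andP[_] := truncn_itv (sqrtr_ge0 (dyadic_mass n / eps));
  rewrite -/(cell_count n) => h.
have e0 : 0 <= dyadic_mass n / eps by rewrite divr_ge0 ?dyadic_mass_ge0// ltW.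
rewrite mulrC -[leLHS](sqr_sqrtr e0).
have -> : 4 * (cell_count n)%:R ^+ 2 = (2 * (cell_count n)%:R) ^+ 2 :> R by ring.
rewrite ler_pXn2r ?nnegrE ?sqrtr_ge0 ?mulr_ge0//.
by apply: (le_trans (ltW h)); rewrite -natrM ler_nat mul2n -addnn; lia.
Qed.

Lemma g_gt0_of_cell_count n : (0 < cell_count n)%N -> 0 < g (2 ^ n).
Proof.
rewrite cell_count_gt0 => h; have : 0 < dyadic_mass n by exact: lt_le_trans h.
by rewrite /dyadic_mass pmulr_rgt0 ?pow2_gt0.
Qed.

(** With m the count, the first floor lies between m and 2 m - 1 and the second
between 0 and m. *)
Lemma cell_index_bounds n x : (0 < cell_count n)%N -> 2 ^ n <= x -> x < 2 * 2 ^ n ->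
  (0 <= cell_index n x) && (cell_index n x < (2 * cell_count n)%:Z).
Proof.
move=> m0 h1 h2; have p0 := pow2_gt0 n; have g0' := g_gt0_of_cell_count m0.
have m0' : 0 < (cell_count n)%:R :> R by rewrite ltr0n.
have x0 : 0 < x by exact: lt_le_trans h1.
set M : R := (cell_count n)%:R in m0' *.
have a1 : (cell_count n)%:Z <= Num.floor (x * M / 2 ^ n).
  by rewrite floor_ge_int ler_pdivlMr// mulrC ler_pM2r.
have a2 : Num.floor (x * M / 2 ^ n) < (2 * cell_count n)%:Z.
  rewrite floor_lt_int ltr_pdivrMr//.
  have -> : (2 * cell_count n)%:Z%:~R = 2 * M :> R by rewrite -natrM.
  have -> : 2 * M * 2 ^ n = 2 * 2 ^ n * M by ring.
  by rewrite ltr_pM2r.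
have b1 : 0 <= Num.floor (g x * M / g (2 ^ n)).
  by rewrite floor_ge0 divr_ge0 ?mulr_ge0 ?g0// ltW.
have b2 : Num.floor (g x * M / g (2 ^ n)) <= (cell_count n)%:Z.
  rewrite -ltzD1 floor_lt_int intrD; apply: (@le_lt_trans _ _ M).
    by rewrite ler_pdivrMr// mulrC ler_pM2l//; exact: gn.
  by rewrite ltrDl.
move: a1 a2 b1 b2; rewrite /cell_index -/M.
move: (Num.floor (x * M / 2 ^ n)) (Num.floor (g x * M / g (2 ^ n))) => u v.
by move: (cell_count n) => k; lia.
Qed.

Lemma frac_bounds x : 0 < x ->
  let n := dyadic_index x in
  0 <= ((cell_index n x)%:~R / (2 * cell_count n)%:R : R) < 1.
Proof.
move=> x0 /=; have [m0|m0] := posnP (cell_count (dyadic_index x)).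
  by rewrite m0 muln0 invr0 mulr0 lexx ltr01.
have /andP[l0 l1] := cell_index_bounds m0 (dyadic_index_le x0) (dyadic_index_gt x0).
rewrite divr_ge0 ?ler0z// ltr_pdivrMr ?ltr0n ?muln_gt0 ?m0// mul1r.
by rewrite -(ltr_int R) in l1.
Qed.

Lemma cell_label_bounds x : 0 < x ->
  (dyadic_index x)%:~R <= cell_label x < (dyadic_index x)%:~R + 1.
Proof.
move=> x0; rewrite /cell_label x0; have /andP[h1 h2] := frac_bounds x0.
by rewrite lerDl h1 ltrD2l.
Qed.

Lemma floor_cell_label x : 0 < x -> Num.floor (cell_label x) = dyadic_index x.
Proof. by move=> x0; apply: floor_def; rewrite intrD; exact: cell_label_bounds. Qed.

Lemma floors_mono x y : 0 < x -> x <= y ->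
  Num.floor (x * (cell_count (dyadic_index x))%:R / 2 ^ dyadic_index x)
    <= Num.floor (y * (cell_count (dyadic_index x))%:R / 2 ^ dyadic_index x) /\
  Num.floor (g y * (cell_count (dyadic_index x))%:R / g (2 ^ dyadic_index x))
    <= Num.floor (g x * (cell_count (dyadic_index x))%:R / g (2 ^ dyadic_index x)).
Proof.
move=> x0 xy; split; apply: le_floor; apply: ler_wpM2r.
- by rewrite invr_ge0 ltW// pow2_gt0.
- by rewrite ler_wpM2r.
- by rewrite invr_ge0 g0 ?pow2_gt0.
- by rewrite ler_wpM2r// gn.
Qed.

Lemma cell_label_mono x y : 0 < x -> x <= y -> cell_label x <= cell_label y.
Proof.
move=> x0 xy; have y0 : 0 < y by exact: lt_le_trans xy.
have := dyadic_index_mono x0 xy; rewrite le_eqVlt => /predU1P[e|lt].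
  rewrite /cell_label x0 y0 -e lerD2l ler_wpM2r ?invr_ge0// ler_int.
  by have [f1 f2] := floors_mono x0 xy; rewrite /cell_index lerB.
have /andP[_ h1] := cell_label_bounds x0; have /andP[h2 _] := cell_label_bounds y0.
apply: (le_trans (ltW h1)); apply: le_trans h2.
by rewrite -[X in _ + X]/(1%:~R) -intrD ler_int lezD1.
Qed.

(** Equal labels force equality of both floors, since both are monotone; two
points with the same floors are close, and so are their values under g. *)
Lemma cell_label_eq x y : 0 < x -> x <= y -> cell_label x = cell_label y ->
  dyadic_index x = dyadic_index y /\
  ((0 < cell_count (dyadic_index x))%N ->
    y - x <= 2 ^ dyadic_index x / (cell_count (dyadic_index x))%:R /\
      g x - g y <= g (2 ^ dyadic_index x) / (cell_count (dyadic_index x))%:R).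
Proof.
move=> x0 xy e; have y0 : 0 < y by exact: lt_le_trans xy.
have en : dyadic_index x = dyadic_index y by rewrite -(floor_cell_label x0)
  -(floor_cell_label y0) e.
split => // m0; have M0 : 0 < (cell_count (dyadic_index x))%:R :> R by rewrite
  ltr0n.
have el : cell_index (dyadic_index x) x = cell_index (dyadic_index x) y.
  move: e; rewrite /cell_label x0 y0 -en => /addrI/mulIf h.
  by apply: (@intr_inj R); apply: h; rewrite invr_eq0 pnatr_eq0 -lt0n muln_gt0.
have [f1 f2] := floors_mono x0 xy.
move: el f1 f2; rewrite /cell_index.
set fx := Num.floor (x * _ / _); set fy := Num.floor (y * _ / _).
set hx := Num.floor (g x * _ / _); set hy := Num.floor (g y * _ / _) => el f1 f2.
have e1 : fx = fy by lia.
have e2 : hx = hy by lia.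
have gp := g_gt0_of_cell_count m0; have pp := pow2_gt0 (dyadic_index x).
have diff (u v w : R) : 0 < w ->
  Num.floor (u * (cell_count (dyadic_index x))%:R / w) =
    Num.floor (v * (cell_count (dyadic_index x))%:R / w) ->
      v - u <= w / (cell_count (dyadic_index x))%:R.
  move=> w0 euv; rewrite ler_pdivlMr// mulrBl.
  have h1 := floor_le (u * (cell_count (dyadic_index x))%:R / w).
  have h2 := floorD1_gt (v * (cell_count (dyadic_index x))%:R / w).
  rewrite -euv intrD in h2; rewrite ler_pdivlMr// in h1.
  rewrite ltr_pdivrMr// mulrDl mul1r in h2; lra.
by split; apply: diff.
Qed.

Lemma g_dyadic_index x : 0 < x -> g x <= g (2 ^ dyadic_index x).
Proof. by move=> x0; apply: gn; [exact: pow2_gt0|exact: dyadic_index_le]. Qed.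

(** The dyadic mass is below eps here, and 1 / 2^n is less than 2 / x. *)
Lemma g_small x : 0 < x -> cell_count (dyadic_index x) = 0%N ->
  g (2 ^ dyadic_index x) <= 2 * eps * x `^ (-1).
Proof.
move=> x0 m0; rewrite (powR_inv1 (ltW x0)) ler_pdivlMr//.
have : ~~ (0 < cell_count (dyadic_index x))%N by rewrite m0.
rewrite cell_count_gt0 -ltNge /dyadic_mass => h.
have gg : 0 <= g (2 ^ dyadic_index x) by rewrite g0 ?pow2_gt0.
apply: (@le_trans _ _ (g (2 ^ dyadic_index x) * (2 * 2 ^ dyadic_index x))).
  by rewrite ler_wpM2l// ltW// dyadic_index_gt.
rewrite mulrCA ler_pM2l// mulrC; exact: ltW.
Qed.

Definition labels (S : seq int) : seq R :=
  [seq n%:~R + i%:R / (2 * cell_count n)%:R | n <- S,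
    i <- iota 0 (2 * cell_count n)].

Lemma size_labels S : size (labels S) = (\sum_(n <- S) 2 * cell_count n)%N.
Proof.
rewrite size_allpairs_dep sumnE big_map.
by apply: eq_bigr => n _; rewrite size_iota.
Qed.

Lemma cell_label_in_labels S x : 0 < x -> dyadic_index x \in S ->
  (0 < cell_count (dyadic_index x))%N -> cell_label x \in labels S.
Proof.
move=> x0 nS m0; rewrite /cell_label x0.
have /andP[l0 l1] := cell_index_bounds m0 (dyadic_index_le x0) (dyadic_index_gt x0).
apply/allpairsPdep; exists (dyadic_index x), `|cell_index (dyadic_index x) x|%N;
  split => //.
  by rewrite mem_iota add0n /=; lia.
by rewrite -[in LHS](gez0_abs l0).
Qed.

Lemma cell_label_up t : exists T, forall x, 0 < x -> cell_label x <= t -> x <= T.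
Proof.
exists (expR ((t + 1) * ln 2)) => x x0 h.
have /andP[h1 _] := cell_label_bounds x0.
rewrite -[leLHS]lnK ?posrE// ler_expR -ler_pdivrMr ?ln2_gt0//.
have := floorD1_gt (ln x / ln (2 : R)); rewrite intrD -/(dyadic_index x); lra.
Qed.

Lemma cell_label_lo t : exists2 c, 0 < c & forall x, 0 < x ->
  t <= cell_label x -> c <= x.
Proof.
exists (expR ((t - 1) * ln 2)); first exact: expR_gt0.
move=> x x0 h; have /andP[_ h1] := cell_label_bounds x0.
rewrite -[leRHS]lnK ?posrE// ler_expR -ler_pdivlMr ?ln2_gt0//.
have := floor_le (ln x / ln (2 : R)); rewrite -/(dyadic_index x); lra.
Qed.

Lemma measurable_cell_label : measurable_fun (setT : set TR) (cell_label : TR -> R).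
Proof.
have -> : cell_label = cell_label \_ H.
  apply/funext => x; rewrite patchE; case: ifPn => // xH.
  rewrite /cell_label; case: ifPn => // x0; move: xH; rewrite notin_setE => xH.
  by exfalso; apply: xH; apply/halflineP.
apply: (measurable_restrictT _ _).1 => //.
exact: nondecreasing_measurable_halfline cell_label_mono.
Qed.

End Labels.

End DyadicLabels.

(** * Approximation numbers of the kernels Phi(max(x, y)) *)

Section MaxKernels.
Variable R : realType.
Local Notation C := (R[i])%type.
Local Notation TR := (measurableTypeR R).
Local Notation H := (@halfline R).

Definition max_kernel (Phi : R -> C) (x y : R) : C := Phi (Num.max x y).

Lemma kmeasurable_max_kernel (Phi : R -> C) :
  measurable_fun (setT : set TR) (fun x : TR => complex.Re (Phi x)) ->
  measurable_fun (setT : set TR) (fun x : TR => complex.Im (Phi x)) ->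
  kmeasurable (max_kernel Phi).
Proof.
move=> m1 m2.
have m : measurable_fun setT (fun z : TR * TR => Num.max z.1 z.2 : TR).
  by apply: measurable_maxr; [exact: measurable_fst|exact: measurable_snd].
by split; [exact: (measurableT_comp m1 m)|exact: (measurableT_comp m2 m)].
Qed.

Lemma kmeasurableB (k k' : R -> R -> C) : kmeasurable k -> kmeasurable k' ->
  kmeasurable (fun x y => k x y - k' x y).
Proof.
move=> [m1 m2] [m1' m2']; split.
- have -> : (fun z : TR * TR => complex.Re (k z.1 z.2 - k' z.1 z.2)) =
     (fun z : TR * TR => complex.Re (k z.1 z.2) - complex.Re (k' z.1 z.2)).
    by apply/funext => z; case: (k z.1 z.2); case: (k' z.1 z.2).
  exact: measurable_funB.
- have -> : (fun z : TR * TR => complex.Im (k z.1 z.2 - k' z.1 z.2)) =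
     (fun z : TR * TR => complex.Im (k z.1 z.2) - complex.Im (k' z.1 z.2)).
    by apply/funext => z; case: (k z.1 z.2); case: (k' z.1 z.2).
  exact: measurable_funB.
Qed.

Section Approx.
Variables (g : R -> R) (Phi : R -> C).
Hypothesis g0 : forall x, 0 < x -> 0 <= g x.
Hypothesis gn : forall x y, 0 < x -> x <= y -> g y <= g x.
Hypothesis m1 : measurable_fun (setT : set TR) (fun x : TR => complex.Re (Phi x)).
Hypothesis m2 : measurable_fun (setT : set TR) (fun x : TR => complex.Im (Phi x)).
Hypothesis Phig : forall x, 0 < x -> cabs (Phi x) <= g x.
Hypothesis PhiV : forall x y, 0 < x -> x <= y -> cabs (Phi y - Phi x) <= g x - g y.
Variable Bd : R.
Hypothesis Bd0 : 0 < Bd.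
Hypothesis bbB : forall n, dyadic_mass g n <= Bd.

Lemma Phi_le_inv x : 0 < x -> cabs (Phi x) <= 2 * Bd * x `^ (-1).
Proof.
move=> x0; rewrite (powR_inv1 (ltW x0)) ler_pdivlMr//.
have gx : 0 <= g x by exact: g0.
apply: (@le_trans _ _ (g x * x)); first by rewrite ler_wpM2r ?Phig// ltW.
apply: (@le_trans _ _ (g x * (2 * 2 ^ dyadic_index x))).
  by rewrite ler_wpM2l// ltW// dyadic_index_gt.
rewrite mulrCA ler_pM2l// mulrC; apply: le_trans (bbB (dyadic_index x)).
by rewrite /dyadic_mass ler_pM2l ?pow2_gt0//; exact: g_dyadic_index.
Qed.

Section Eps.
Variable eps : R.
Hypothesis eps0 : 0 < eps.
Variable S : seq int.
Hypothesis hS : forall n, eps <= dyadic_mass g n -> n \in S.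

Local Notation cell_count := (cell_count g eps).
Local Notation L := (undup (labels g eps S)).
Local Notation kappa := (label_kernel Phi (cell_label g eps) L).

(** This bounds the oscillation of Phi over a cell, on a neighbourhood of the
diagonal containing the square of the cell.  Only the dyadic index and the
distance of x and y enter, which makes it symmetric and easy to integrate. *)
Definition cell_bound (x y : R) : R :=
  if (dyadic_index x == dyadic_index y) &&
    (`|x - y| <= 2 ^ dyadic_index x / (cell_count (dyadic_index x))%:R)
  then g (2 ^ dyadic_index x) / (cell_count (dyadic_index x))%:R else 0.

Lemma cell_bound_ge0 x y : 0 <= cell_bound x y.
Proof.
rewrite /cell_bound; case: ifP => // _.
by rewrite divr_ge0 ?g0 ?pow2_gt0.
Qed.

Lemma cell_boundC x y : cell_bound x y = cell_bound y x.
Proof. by rewrite /cell_bound eq_sym distrC; case: eqVneq => [->|]. Qed.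

(** The height of the bump times its width is the dyadic mass divided by the
square of the cell count, which is at most 4 * eps. *)
Lemma cell_near_diag (e : R) (F : R -> R -> R) :
  (forall x y, 0 < x -> 0 < y ->
    F x y <= e * Num.max x y `^ (-1) + cell_bound x y) ->
  forall x, H x -> near_diag_bound e (4 * eps) (F x) x.
Proof.
move=> hF x /halflineP x0.
exists (g (2 ^ dyadic_index x) / (cell_count (dyadic_index x))%:R),
  (2 ^ dyadic_index x / (cell_count (dyadic_index x))%:R).
have p0 := pow2_gt0 R (dyadic_index x).
split.
- by rewrite divr_ge0 ?g0 ?pow2_gt0.
- by rewrite divr_ge0// ltW.
- apply: le_trans (dyadic_mass_div_le g0 eps0 (dyadic_index x)).
  rewrite /dyadic_mass expr2 invfM mulrACA; apply: ler_wpM2r; last by rewrite mulrC.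
  by rewrite mulr_ge0 ?invr_ge0.
- move=> y /halflineP y0; apply: (le_trans (hF _ _ x0 y0)); rewrite lerD2l.
  rewrite /cell_bound; case: eqVneq => [e'|_] /=; last first.
    by case: ifP => // _; rewrite divr_ge0 ?g0 ?pow2_gt0.
  case: ifP => //= h; rewrite ifT//.
  apply: (le_trans (ltW (dyadic_index_gt x0))); rewrite e'.
  apply: (@le_trans _ _ (2 * y)); first by rewrite ler_pM2l// dyadic_index_le.
  by rewrite ler_pM2r// ler_nat.
Qed.

Lemma label_part_near (z : R) : 0 < z ->
  cabs (Phi z - label_part Phi (cell_label g eps) L z) <= 2 * eps * z `^ (-1).
Proof.
move=> z0; rewrite /label_part; case: ifPn => hz.
  by rewrite subrr cabs0 mulr_ge0 ?powR_ge0// mulr_ge0// ltW.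
rewrite subr0; apply: (le_trans (Phig z0));
  apply: (le_trans (g_dyadic_index gn z0)).
apply: g_small => //; apply/eqP; rewrite -leqn0 leqNgt; apply: contra hz => m0.
rewrite mem_undup; apply: cell_label_in_labels => //.
by apply: hS; rewrite -cell_count_gt0.
Qed.

(** If the label kernel picks the larger of x and y, the difference is 0, or Phi
itself where Phi is small.  Otherwise the labels are equal, and the difference
is an increment of Phi inside a cell, or again Phi where Phi is small. *)
Lemma kernel_diff_bound x y : 0 < x -> 0 < y ->
  cabs (max_kernel Phi x y - kappa x y) <=
    2 * eps * Num.max x y `^ (-1) + cell_bound x y.
Proof.
move=> x0 y0; rewrite /max_kernel /label_kernel.
have [xy|yx] := ltP x y; last first.
  rewrite (cell_label_mono g0 gn eps0 y0 yx).
  by apply: (le_trans (label_part_near x0)); rewrite lerDl cell_bound_ge0.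
have [|lt] := leP (cell_label g eps y) (cell_label g eps x); last first.
  by apply: (le_trans (label_part_near y0)); rewrite lerDl cell_bound_ge0.
move=> h; have e : cell_label g eps x = cell_label g eps y.
  by apply/eqP; rewrite eq_le h (cell_label_mono g0 gn eps0 x0 (ltW xy)).
have [en hm] := cell_label_eq g0 gn eps0 x0 (ltW xy) e.
have [m0|m0] := posnP (cell_count (dyadic_index x)); last first.
  have [h1 h2] := hm m0.
  rewrite /cell_bound en eqxx /= -en distrC gtr0_norm ?subr_gt0// h1.
  rewrite /label_part; case: ifPn => [_|]; last first.
    rewrite mem_undup cell_label_in_labels//.
    by apply: hS; rewrite -(cell_count_gt0 g0 eps0).
  apply: (le_trans (PhiV x0 (ltW xy))); apply: (le_trans h2).
  by rewrite lerDr mulr_ge0 ?powR_ge0// mulr_ge0// ltW.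
apply: (@le_trans _ _ (2 * eps * y `^ (-1))); last by rewrite lerDl cell_bound_ge0.
rewrite /label_part e -/(label_part Phi (cell_label g eps) L y).
have gy : g (2 ^ dyadic_index y) <= 2 * eps * y `^ (-1).
  by apply: g_small => //; rewrite -en.
case: ifPn => _; last first.
  rewrite subr0; apply: le_trans gy; apply: (le_trans (Phig y0));
    exact: g_dyadic_index.
apply: (le_trans (PhiV x0 (ltW xy))); apply: le_trans gy.
rewrite -en; apply: (@le_trans _ _ (g x)); last exact: g_dyadic_index.
by rewrite gerBl g0.
Qed.

Lemma schur_bounded_diff :
  schur_bounded (24 * eps) (fun x y => max_kernel Phi x y - kappa x y).
Proof.
(* 2 * eps is the Hardy part and 4 * eps the contribution of the cells. *)
have -> : 24 * eps = 4 * (2 * eps + 4 * eps) by ring.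
have e0 := ltW eps0.
apply: schur_bounded_near_diag.
- by rewrite mulr_gt0.
- by rewrite mulr_ge0.
- apply: kmeasurableB; first exact: kmeasurable_max_kernel.
  by apply: kmeasurable_label_kernel => //; exact: measurable_cell_label.
- by apply: (cell_near_diag (F := fun x y =>
    cabs (max_kernel Phi x y - kappa x y)));
    exact: kernel_diff_bound.
- apply: (cell_near_diag (F := fun y x =>
    cabs (max_kernel Phi x y - kappa x y))) => x y x0 y0.
  by rewrite maxC cell_boundC; exact: kernel_diff_bound.
Qed.

Lemma max_kernel_bound x y : 0 < x -> 0 < y ->
  cabs (max_kernel Phi x y) <= 2 * Bd * Num.max x y `^ (-1).
Proof.
by move=> x0 y0; apply: Phi_le_inv; rewrite lt_max x0.
Qed.

Lemma schur_bounded_max_kernel :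
  schur_bounded (4 * (2 * Bd + 4 * eps)) (max_kernel Phi).
Proof.
have e0 := ltW eps0.
apply: schur_bounded_near_diag.
- by rewrite mulr_gt0.
- by rewrite mulr_ge0.
- exact: kmeasurable_max_kernel.
- apply: (cell_near_diag (F := fun x y => cabs (max_kernel Phi x y))) => x y x0 y0.
  by apply: (le_trans (max_kernel_bound x0 y0)); rewrite lerDl cell_bound_ge0.
- apply: (cell_near_diag (F := fun y x => cabs (max_kernel Phi x y))) => x y x0 y0.
  by rewrite maxC; apply: (le_trans (max_kernel_bound y0 x0));
    rewrite lerDl cell_bound_ge0.
Qed.

Lemma label_kernel_bound x y : 0 < x -> 0 < y ->
  cabs (kappa x y) <= (2 * Bd + 2 * eps) * Num.max x y `^ (-1) + cell_bound x y.
Proof.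
move=> x0 y0; have ->
  : kappa x y = max_kernel Phi x y + - (max_kernel Phi x y - kappa x y).
  by rewrite opprB addrC subrK.
apply: (le_trans (cabsD _ _)); rewrite cabsN mulrDl -addrA.
by apply: lerD; [exact: max_kernel_bound|exact: kernel_diff_bound].
Qed.

Lemma schur_bounded_label_kernel :
  schur_bounded (4 * (2 * Bd + 2 * eps + 4 * eps)) kappa.
Proof.
have e0 := ltW eps0.
apply: schur_bounded_near_diag.
- by rewrite addr_gt0// mulr_gt0.
- by rewrite mulr_ge0.
- by apply: kmeasurable_label_kernel => //; exact: measurable_cell_label.
- by apply: (cell_near_diag (F := fun x y => cabs (kappa x y)));
    exact: label_kernel_bound.
- apply: (cell_near_diag (F := fun y x => cabs (kappa x y))) => x y x0 y0.
  by rewrite maxC cell_boundC; exact: label_kernel_bound.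
Qed.

Lemma singular_number_max_kernel_le N : (\sum_(n <- S) 4 * cell_count n <= N)%N ->
  (singular_number N (integral_operator (max_kernel Phi)) <= (48 * eps)%:E)%E.
Proof.
move=> hN; have -> : 48 * eps = 2 * (24 * eps) by ring.
apply: (@singular_number_integral_operator_le _ (label_tensors Phi (cell_label g
  eps) L) _ _ _ _ kappa).
- exact: schur_bounded_max_kernel.
- exact: schur_bounded_label_kernel.
- exact: schur_bounded_diff.
- apply: (@label_tensors_L2 _ _ _ g) => //.
  + exact: measurable_cell_label.
  + exact: cell_label_up.
  + exact: cell_label_lo.
- by move=> x y _ _; rewrite label_kernelE// undup_uniq.
- rewrite size_label_tensors; apply: leq_trans hN.
  apply: (@leq_trans (2 * size (labels g eps S))).
    by rewrite leq_mul2l size_undup orbT.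
  rewrite size_labels big_distrr /=; apply: leq_sum => n _; lia.
Qed.

End Eps.
End Approx.

End MaxKernels.

(** * From approximation thresholds to summability *)

Section Summation.
Variable R : realType.

(** A term whose index n satisfies N j <= n < N (j + 1) is at most c * eps j.
Instead of choosing j as a function of n, the proof bounds the p-th power of
each term by the sum of all (c * eps j)^p with n < N (j + 1) and a remainder (c
* eps J)^p; this also covers the case where N is bounded or not monotone. *)
Lemma summable_of_thresholds (s : nat -> \bar R) (p c M : R) (eps : nat -> R)
    (N : nat -> nat) :
  0 < p -> 0 < c -> (forall n, 0 <= s n)%E -> (forall j, 0 < eps j) -> N 0 = 0%N ->
  (forall j n, (N j <= n)%N -> (s n <= (c * eps j)%:E)%E) ->
  (forall J, \sum_(j < J) eps j `^ p * (N j.+1)%:R <= M) ->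
  (forall d, 0 < d -> exists J, eps J `^ p <= d) ->
  (\sum_(0 <= n <oo) poweR (s n) p < +oo)%E.
Proof.
move=> p0 c0 s0 e0 N0 hs hM hlim.
have sfin n : s n = (fine (s n))%:E.
  rewrite fineK// ge0_fin_numE//; apply: (le_lt_trans (hs 0%N n _));
    last exact: ltry.
  by rewrite N0.
pose t n := fine (s n) `^ p.
have tE n : poweR (s n) p = (t n)%:E by rewrite sfin poweR_EFin.
have t_le j n : (N j <= n)%N -> t n <= c `^ p * eps j `^ p.
  move=> /hs; rewrite sfin lee_fin => h.
  rewrite -(powRM _ (ltW c0) (ltW (e0 j))); apply: ge0_ler_powR => //.
  - exact: ltW.
  - by rewrite nnegrE fine_ge0.
  - by rewrite nnegrE mulr_ge0// ltW.
have key J n : t n <= c `^ p * eps J `^ p +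
    \sum_(j < J) c `^ p * eps j `^ p * (n < N j.+1)%:R.
  elim: J => [|J IH]; first by rewrite big_ord0 addr0 t_le// N0.
  have sum0 K : 0 <= \sum_(j < K) c `^ p * eps j `^ p * (n < N j.+1)%:R.
    by apply: sumr_ge0 => j _; rewrite !mulr_ge0 ?powR_ge0.
  have [h|h] := leqP (N J.+1) n.
    by apply: (le_trans (t_le _ _ h)); rewrite lerDl.
  apply: (le_trans IH); rewrite big_ord_recr /= h mulr1 [leLHS]addrC.
  by rewrite lerDr mulr_ge0 ?powR_ge0.
have partial P : \sum_(n < P) t n <= 1 + c `^ p * M.
  have cp : 0 < c `^ p by exact: powR_gt0.
  have [|J hJ] := hlim (c `^ p * P.+1%:R)^-1; first by rewrite invr_gt0 mulr_gt0.
  apply: (@le_trans _ _ (\sum_(n < P) (c `^ p * eps J `^ p +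
     \sum_(j < J) c `^ p * eps j `^ p * (n < N j.+1)%:R))).
    by apply: ler_sum => n _; exact: key.
  rewrite big_split /=; apply: lerD.
    rewrite sumr_const card_ord -mulr_natr mulrAC.
    apply: (@le_trans _ _ (c `^ p * P.+1%:R * eps J `^ p)).
      by rewrite ler_wpM2r ?powR_ge0// ler_wpM2l ?ler_nat// ltW.
    by rewrite -ler_pdivlMl ?mulr_gt0// mulr1.
  rewrite exchange_big /=;
    apply: (@le_trans _ _ (c `^ p * \sum_(j < J) eps j `^ p * (N j.+1)%:R));
      last first.
    by rewrite ler_pM2l.
  rewrite mulr_sumr; apply: ler_sum => j _; rewrite -mulr_sumr -mulrA.
  rewrite ler_wpM2l ?powR_ge0// ler_wpM2l ?powR_ge0// -natr_sum ler_nat.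
  have [_] : ((\sum_(i < P) (i < N j.+1)%N <= P) /\
    (\sum_(i < P) (i < N j.+1)%N <= N j.+1))%N.
    elim: (P) => [|Q [IH1 IH2]]; first by rewrite big_ord0.
    rewrite big_ord_recr /=; case: ltnP => h /=; rewrite ?addn1 ?addn0.
      by split; [rewrite ltnS|exact: leq_ltn_trans h].
    by split=> //; exact: leqW.
  by [].
apply: (@le_lt_trans _ _ (1 + c `^ p * M)%:E); last exact: ltry.
apply: lime_le; first by apply: is_cvg_nneseries => n _ _; exact: poweR_ge0.
apply: nearW => P; rewrite big_mkord (eq_bigr (fun n : 'I_P => (t n)%:E));
  last first.
  by move=> n _; rewrite tE.
rewrite sumEFin lee_fin; exact: partial.
Qed.

(** Multiplied by 1 - r^q, the term at e is at most the increment of min(e, b)^q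
between e * r and e, so the sum telescopes. *)
Lemma truncated_geometric_sum (b q r e1 : R) J : 0 < q -> 0 < r < 1 -> 0 <= b ->
  0 < e1 ->
  (\sum_(j < J) (if e1 * r ^+ j <= b then (e1 * r ^+ j) `^ q else 0)) * (1 - r `^ q)
    <= b `^ q.
Proof.
move=> q0 /andP[r0 r1] b0 e0.
have rq1 : r `^ q < 1.
  apply: (@lt_le_trans _ _ (1 `^ q)); last by rewrite powR1.
  by apply: gt0_ltr_powR; rewrite ?nnegrE// ltW.
pose h (e : R) := Num.min e b `^ q.
have hb e : 0 <= e -> h e <= b `^ q.
  move=> he; apply: ge0_ler_powR; first exact: ltW.
  - by rewrite nnegrE le_min he b0.
  - by rewrite nnegrE.
  - by rewrite ge_min lexx orbT.
have step e : 0 < e ->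
  (if e <= b then e `^ q else 0) * (1 - r `^ q) <= h e - h (e * r).
  move=> he; case: ifPn => eb.
    have erb : e * r <= b.
      by apply: le_trans eb; rewrite -[leRHS]mulr1 ler_pM2l// ltW.
    by rewrite /h min_l// min_l// (powRM _ (ltW he) (ltW r0)) mulrBr mulr1.
  rewrite mul0r subr_ge0 /h; apply: ge0_ler_powR; rewrite ?nnegrE; first exact: ltW.
  - by rewrite le_min b0 mulr_ge0// ltW.
  - by rewrite le_min b0 ltW.
  - rewrite le_min; apply/andP; split; last by rewrite ge_min lexx orbT.
    by rewrite ge_min -[leRHS]mulr1 ler_pM2l// ltW.
have tele : (\sum_(j < J) (if e1 * r ^+ j <= b then (e1 * r ^+ j) `^ q else 0))
  * (1 - r `^ q)
   <= h e1 - h (e1 * r ^+ J).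
  elim: J => [|J IH]; first by rewrite big_ord0 mul0r expr0 mulr1 subrr.
  rewrite big_ord_recr /= mulrDl.
  apply: (le_trans (lerD IH (step (e1 * r ^+ J) (mulr_gt0 e0 (exprn_gt0 _ r0))))).
  by rewrite exprSr mulrA addrA subrK.
apply: (le_trans tele); apply: (@le_trans _ _ (h e1)); last by rewrite hb ?ltW.
by rewrite gerBl powR_ge0.
Qed.

(** Chebyshev's inequality bounds the number of n with a n >= e. *)
Lemma finite_superlevel (a : int -> R) (p M e : R) : 0 < p -> 0 < e ->
  (forall n, 0 <= a n) ->
  (forall r : seq int, uniq r -> \sum_(n <- r) a n `^ p <= M) ->
  exists2 r : seq int, uniq r & forall n, (n \in r) = (e <= a n).
Proof.
move=> p0 e0 a0 hM.
have fin : finite_set [set n | e <= a n].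
  apply: contrapT => /infinite_set_fset inf.
  have ep : 0 < e `^ p by exact: powR_gt0.
  have [B BA] := inf (Num.truncn (M / e `^ p)).+1.
  move=> hB; have := hM _ (finmap.fset_uniq B); apply/negP; rewrite -ltNge.
  apply: (@lt_le_trans _ _ (e `^ p * (size (finmap.enum_fset B))%:R)).
    rewrite -ltr_pdivrMl// mulrC.
    by apply: lt_le_trans (truncnS_gt _) _; rewrite ler_nat.
  rewrite mulr_natr -iter_addr_0 -[X in iter X](count_predT (finmap.enum_fset B)).
  rewrite -(big_const_seq 0 +%R (finmap.enum_fset B) predT) big_seq [leRHS]big_seq.
  apply: ler_sum => n nB; apply: ge0_ler_powR; rewrite ?nnegrE;
    [exact: ltW|exact: ltW|exact: a0|].
  by have := BA n nB.
have /finite_seqP[s sE] := fin.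
exists (undup s); first exact: undup_uniq.
have mem n : (e <= a n) = [set` s] n :> Prop by rewrite -sE.
by move=> n; rewrite mem_undup; apply/idP/idP; rewrite mem.
Qed.

(** After exchanging the sums over j and n, the thresholds not exceeding a n
contribute to the sum over j a geometric sum with exponent p - 1/2 > 0, hence at
most a multiple of (a n)^(p - 1/2); the square root in the bound on m j n
supplies the missing factor (a n)^(1/2). *)
Lemma weighted_counts_le (a : int -> R) (p M Bd : R) (eps : nat -> R)
    (r : nat -> seq int) (m : nat -> int -> nat) :
  2^-1 < p -> (forall n, 0 <= a n) -> 0 < Bd ->
  (forall s : seq int, uniq s -> \sum_(n <- s) a n `^ p <= M) ->
  (forall j, eps j = Bd * 4^-1 ^+ j) ->
  (forall j, uniq (r j)) -> (forall j n, (n \in r j) = (eps j <= a n)) ->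
  (forall j n, (m j n)%:R <= Num.sqrt (a n / eps j)) ->
  forall J, \sum_(j < J) eps j `^ p * (\sum_(n <- r j.+1) 4 * m j.+1 n)%N%:R
    <= 4 `^ p * 4 / (1 - 4^-1 `^ (p - 2^-1)) * M.
Proof.
move=> p2 a0 B0 hM epsE ur hr hm J; set q := p - 2^-1.
have q0 : 0 < q by rewrite subr_gt0.
have e0 j : 0 < eps j by rewrite epsE mulr_gt0// exprn_gt0// invr_gt0.
have epsS j : eps j = 4 * eps j.+1.
  by rewrite !epsE exprS; field.
have quarter : 4^-1 `^ q < 1 :> R.
  apply: (@lt_le_trans _ _ (1 `^ q)); last by rewrite powR1.
  by apply: gt0_ltr_powR => //; rewrite ?nnegrE; lra.
pose f j n := if eps j.+1 <= a n then eps j.+1 `^ q else 0.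
have le1 j : (j < J)%N -> eps j `^ p * (\sum_(n <- r j.+1) 4 * m j.+1 n)%N%:R <=
    \sum_(n <- r J) 4 `^ p * 4 * (a n `^ 2^-1 * f j n).
  move=> jJ; have e := e0 j.+1.
  have sub : {subset r j.+1 <= r J}.
    move=> n; rewrite !hr; apply: le_trans.
    rewrite !epsE ler_pM2l// ler_wiXn2l//; lra.
  have -> : \sum_(n <- r J) 4 `^ p * 4 * (a n `^ 2^-1 * f j n) =
      \sum_(n <- r j.+1) 4 `^ p * 4 * (a n `^ 2^-1 * eps j.+1 `^ q).
    rewrite (bigID (fun n => eps j.+1 <= a n)) /= [X in _ + X]big1 ?addr0;
      last first.
      by move=> n /negbTE h; rewrite /f h !mulr0.
    rewrite -big_filter (perm_big (r j.+1)); last first.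
      apply: uniq_perm; rewrite ?filter_uniq// => n.
      rewrite mem_filter -hr; apply/andP/idP => [[]//|h]; split => //.
      exact: sub.
    by apply: eq_big_seq => n; rewrite hr /f => ->.
  rewrite natr_sum mulr_sumr; apply: ler_sum => n _.
  have e' := ltW e.
  rewrite natrM epsS (powRM _ (ler0n _ 4) e') -!mulrA ler_pM2l ?powR_gt0//.
  rewrite mulrCA ler_pM2l// mulrC.
  apply: (@le_trans _ _ (Num.sqrt (a n / eps j.+1) * eps j.+1 `^ p)).
    by rewrite ler_wpM2r ?powR_ge0.
  have ei : 0 <= (eps j.+1)^-1 by rewrite invr_ge0.
  rewrite -powR12_sqrt ?divr_ge0// (powRM _ (a0 n) ei) -mulrA.
  rewrite -(powR_inv1 e') -powRrM -powRD ?(gt_eqF e) ?implybT//.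
  by rewrite mulN1r addrC.
apply: (@le_trans _ _ (\sum_(j < J) \sum_(n <- r J)
  4 `^ p * 4 * (a n `^ 2^-1 * f j n))).
  by apply: ler_sum => j _; exact: le1.
rewrite exchange_big /=.
have D0 : 0 < 1 - 4^-1 `^ q :> R by rewrite subr_gt0.
apply: (@le_trans _ _ (\sum_(n <- r J) 4 `^ p * 4 / (1 - 4^-1 `^ q) * a n `^ p));
  last first.
  rewrite -mulr_sumr ler_wpM2l ?hM//.
  by rewrite divr_ge0 ?mulr_ge0 ?powR_ge0// ltW.
apply: ler_sum => n _; rewrite -mulr_sumr -[leRHS]mulrA.
rewrite ler_pM2l ?mulr_gt0 ?powR_gt0// -mulr_sumr ler_pdivlMl//.
have -> : a n `^ p = a n `^ q * a n `^ 2^-1.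
  rewrite -powRD ?subrK// gt_eqF//; apply: lt_trans p2; rewrite invr_gt0//.
rewrite mulrCA [leRHS]mulrC ler_wpM2l ?powR_ge0// mulrC.
have := @truncated_geometric_sum (a n) q 4^-1 (eps 1%N) J q0 _ (a0 n) (e0 1%N).
have -> : (0 < (4^-1 : R) < 1) = true by lra.
move=> /(_ isT); apply: le_trans; rewrite ler_pM2r//.
by apply: ler_sum => j _; rewrite /f !epsE exprS expr1 mulrA.
Qed.

End Summation.

(** * Monotone functions in the space X_p *)

Section MonotoneXp.
Variable R : realType.
Local Notation C := (R[i])%type.
Local Notation mu := (@lebesgue_measure R).
Local Notation TR := (measurableTypeR R).
Local Notation H := (@halfline R).

Definition Xp_term (p : R) (phi : R -> C) (n : int) : \bar R :=
  ((2 `^ (n%:~R * p / 2))%:E *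
      poweR (\int[mu]_(x in `[(2 : R) ^ n, (2 : R) ^ (n + 1)])
               ((cabs (phi x)) ^+ 2)%:E) (p / 2))%E.

Lemma Xp_term_ge0 p phi n : (0 <= Xp_term p phi n)%E.
Proof. by rewrite /Xp_term mule_ge0 ?poweR_ge0// lee_fin powR_ge0. Qed.

Lemma Xp_sum_le p phi : Xp p phi -> exists M : R,
  forall r : seq int, uniq r -> (\sum_(n <- r) Xp_term p phi n <= M%:E)%E.
Proof.
move=> [_ fin]; exists (fine (\esum_(n in [set: int]) Xp_term p phi n)) => r ur.
rewrite fineK; last first.
  by rewrite ge0_fin_numE//; apply: esum_ge0 => n _; exact: Xp_term_ge0.
apply: esum_ge; exists [set` r]; first by split => //; exact: finite_seq.
by rewrite -fsbig_seq.
Qed.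

Lemma dyadic_sub_halfline n : `[(2 : R) ^ n, (2 : R) ^ (n + 1)] `<=` H.
Proof.
move=> x /=; rewrite in_itv /= => /andP[h _]; apply/halflineP.
exact: lt_le_trans (pow2_gt0 R n) h.
Qed.

Lemma Xp_term_ge p phi n c : 0 < p -> cmeasurable phi -> 0 <= c ->
  (forall x, 2 ^ n <= x <= 2 ^ (n + 1) -> c <= cabs (phi x)) ->
  (((2 ^ n * c) `^ p)%:E <= Xp_term p phi n)%E.
Proof.
move=> p0 mphi c0 hc; have P0 := pow2_gt0 R n.
have P0' := ltW P0.
have -> : (2 ^ n * c) `^ p = 2 `^ (n%:~R * p / 2) * (c ^+ 2 * 2 ^ n) `^ (p / 2).
  rewrite -mulrA powRrM powR_intmul// -powRM ?mulr_ge0 ?sqr_ge0//.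
  have -> : 2 ^ n * (c ^+ 2 * 2 ^ n) = (2 ^ n * c) `^ 2.
    by rewrite powR_mulrn ?mulr_ge0// exprMn; ring.
  by rewrite -powRrM mulrCA mulfV// mulr1.
rewrite /Xp_term EFinM; apply: lee_wpmul2l; first by rewrite lee_fin powR_ge0.
rewrite -poweR_EFin; apply: gt0_ler_poweR.
- by rewrite divr_ge0 ?ltW.
- by rewrite in_itv /= leey andbT lee_fin mulr_ge0 ?sqr_ge0.
- rewrite in_itv /= leey andbT; apply: integral_ge0 => x _.
  by rewrite lee_fin sqr_ge0.
pose I : set TR := `[(2 : R) ^ n, (2 : R) ^ (n + 1)]%classic.
have mI : measurable I by exact: measurable_itv.
have -> : (c ^+ 2 * 2 ^ n)%:E = (\int[mu]_(x in I) (cst (c ^+ 2)%:E x))%E.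
  transitivity ((c ^+ 2)%:E * mu I)%E; last by rewrite integral_cst.
  rewrite /I lebesgue_measure_itv /= lte_fin ltr_eXz2l ?ltr1n//.
  rewrite ltzD1 lexx -EFinB pow2S -EFinM; congr (_%:E); ring.
apply: ge0_le_integral => //.
- by move=> x _; rewrite lee_fin sqr_ge0.
- apply/measurable_EFinP; apply: measurable_funX.
  exact: (measurable_funS _ (@dyadic_sub_halfline n) (cmeasurable_cabs mphi)).
- move=> x; rewrite /I /= in_itv /= => hx; rewrite lee_fin.
  by rewrite ler_pXn2r ?nnegrE ?cabs_ge0//; exact: hc.
Qed.

Lemma cabs_real (u : R) : cabs (u%:C)%C = `|u|.
Proof. by rewrite /cabs /= expr0n /= addr0 sqrtr_sqr. Qed.

Lemma nonincreasing_XpP p g : @nonincreasing_Xp R p g ->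
  forall x y, 0 < x -> x <= y -> g y <= g x.
Proof.
move=> [gn _] x y x0 xy; apply: gn => //; apply: mem_set; apply/halflineP => //.
exact: lt_le_trans xy.
Qed.

(** A negative value would keep g away from 0 at infinity, and the terms of the
series defining X_p would grow like 2^(n p). *)
Lemma nonincreasing_Xp_ge0 p g : 0 < p -> @nonincreasing_Xp R p g ->
  forall x, 0 < x -> 0 <= g x.
Proof.
move=> p0 hg x x0; have gn := nonincreasing_XpP hg.
have [_ [mg _]] := hg; have [M hM] := Xp_sum_le hg.2.
rewrite leNgt; apply/negP => gx.
pose d := - g x; have d0 : 0 < d by rewrite oppr_gt0.
pose X := Num.max x ((`|M| `^ p^-1 + 1) / d).
have X0 : 0 < X by rewrite lt_max x0.
pose n := dyadic_index X + 1.
have Xn : X < 2 ^ n by rewrite /n pow2S; exact: dyadic_index_gt.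
have := hM [:: n] isT; rewrite big_seq1.
have lb : (((2 ^ n * d) `^ p)%:E <= Xp_term p (fun x => (g x)%:C%C) n)%E.
  apply: Xp_term_ge => //; first exact: ltW.
  move=> y /andP[ny _]; rewrite cabs_real.
  have xy : x <= y by apply: le_trans ny; apply/ltW; apply: le_lt_trans Xn;
    rewrite le_max lexx.
  have gy := gn _ _ x0 xy.
  by rewrite ltr0_norm ?(le_lt_trans gy)// /d lerN2.
move=> /(le_trans lb); rewrite lee_fin; apply/negP; rewrite -ltNge.
apply: (@le_lt_trans _ _ `|M|); first exact: ler_norm.
have -> : `|M| = (`|M| `^ p^-1) `^ p.
  by rewrite -powRrM mulVf ?gt_eqF// powRr1.
apply: gt0_ltr_powR => //; rewrite ?nnegrE ?powR_ge0//.
  by rewrite mulr_ge0 ?ltW ?pow2_gt0.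
apply: (@lt_le_trans _ _ (`|M| `^ p^-1 + 1)); first by rewrite ltrDl.
by rewrite -ler_pdivrMr//; apply: le_trans (ltW Xn); rewrite le_max lexx orbT.
Qed.

(** On a dyadic interval g is at least its value at the right end point, which
explains the shift of the index by one. *)
Lemma nonincreasing_Xp_sum_le p g : 0 < p -> @nonincreasing_Xp R p g ->
  exists M : R, forall r : seq int, uniq r ->
    \sum_(n <- r) dyadic_mass g n `^ p <= M.
Proof.
move=> p0 hg; have gn := nonincreasing_XpP hg;
  have g0 := nonincreasing_Xp_ge0 p0 hg.
have [_ [mg _]] := hg; have [M hM] := Xp_sum_le hg.2.
exists (2 `^ p * M) => r ur.
have ur' : uniq [seq n - 1 | n <- r] by rewrite map_inj_uniq//; exact: addIr.
have := hM _ ur'; rewrite big_map => h.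
rewrite -lee_fin; apply: (@le_trans _ _ ((2 `^ p)%:E * \sum_(n <- r)
  Xp_term p (fun x => (g x)%:C%C) (n - 1))%E); last first.
  by rewrite EFinM; apply: lee_wpmul2l => //; rewrite lee_fin powR_ge0.
apply: (@le_trans _ _ ((2 `^ p)%:E * \sum_(n <- r) ((2 ^ (n - 1) * g (2 ^ n))
  `^ p)%:E)%E).
  rewrite sumEFin -EFinM lee_fin mulr_sumr; apply: ler_sum => n _.
  have q0 := pow2_gt0 R (n - 1).
  have gn0 : 0 <= g (2 ^ n) by rewrite g0 ?pow2_gt0.
  rewrite -powRM ?mulr_ge0 ?(ltW q0)//.
  by rewrite /dyadic_mass mulrA -pow2S subrK.
apply: lee_wpmul2l; first by rewrite lee_fin powR_ge0.
apply: lee_sum => n _; apply: Xp_term_ge => //; first by rewrite g0 ?pow2_gt0.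
move=> x; rewrite subrK => /andP[h1 h2]; rewrite cabs_real.
have x0 : 0 < x by exact: lt_le_trans (pow2_gt0 R _) h1.
by apply: le_trans (ler_norm _); exact: gn.
Qed.

(** This replaces the triangle inequality, and holds for p < 1 as well. *)
Lemma powRD_le (a b p : R) : 0 <= a -> 0 <= b -> 0 < p ->
  (a + b) `^ p <= 2 `^ p * (a `^ p + b `^ p).
Proof.
move=> a0 b0 p0; wlog ab : a b a0 b0 / a <= b.
  move=> h; have [ab|/ltW ba] := leP a b; first exact: h.
  by rewrite addrC [_ `^ p + _]addrC; exact: h.
apply: (@le_trans _ _ ((2 * b) `^ p)).
  apply: ge0_ler_powR; rewrite ?nnegrE ?addr_ge0 ?mulr_ge0// ?(ltW p0)//.
  by rewrite mulr_natl mulr2n lerD2r.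
by rewrite powRM// ler_wpM2l ?powR_ge0// lerDr powR_ge0.
Qed.

Lemma ae_eq_cintegral (F G : R -> C) : cmeasurable F -> cmeasurable G ->
  ae_eq mu H F G -> cintegral F = cintegral G.
Proof.
move=> [F1 F2] [G1 G2] FG; rewrite /cintegral /Rintegral.
congr Complex; congr fine; apply: ae_eq_integral => //;
  try exact/measurable_EFinP; by apply: filterS FG => x /[apply] ->.
Qed.

Lemma measurable_of_real (g : R -> R) : cmeasurable (fun x => (g x)%:C%C) ->
  measurable_fun H g.
Proof. by case. Qed.

End MonotoneXp.

(** * Schatten class membership *)

Section SchattenMaxKernel.
Variable R : realType.
Local Notation C := (R[i])%type.
Local Notation mu := (@lebesgue_measure R).
Local Notation TR := (measurableTypeR R).
Local Notation H := (@halfline R).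

Lemma schatten_max_kernel (p : R) (g : R -> R) (Phi : R -> C) (M : R) :
  2^-1 < p ->
  (forall x, 0 < x -> 0 <= g x) ->
  (forall x y, 0 < x -> x <= y -> g y <= g x) ->
  measurable_fun (setT : set TR) (fun x : TR => complex.Re (Phi x)) ->
  measurable_fun (setT : set TR) (fun x : TR => complex.Im (Phi x)) ->
  (forall x, 0 < x -> cabs (Phi x) <= g x) ->
  (forall x y, 0 < x -> x <= y -> cabs (Phi y - Phi x) <= g x - g y) ->
  (forall r : seq int, uniq r -> \sum_(n <- r) dyadic_mass g n `^ p <= M) ->
  schatten p (integral_operator (max_kernel Phi)).
Proof.
move=> p2 g0 gn m1 m2 Phig PhiV hM.
have p0 : 0 < p by apply: lt_trans p2; rewrite invr_gt0.
have bb0 := dyadic_mass_ge0 g0.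
(* Strictly above all dyadic masses, so that no interval is subdivided at the
   threshold eps 0. *)
pose Bd := M `^ p^-1 + 1.
have bbB n : dyadic_mass g n < Bd.
  apply: (@le_lt_trans _ _ (M `^ p^-1)); last by rewrite ltrDl.
  have h : dyadic_mass g n `^ p <= M by have := hM [:: n] isT; rewrite big_seq1.
  have -> : dyadic_mass g n = (dyadic_mass g n `^ p) `^ p^-1.
    by rewrite -powRrM mulfV ?gt_eqF// powRr1.
  apply: ge0_ler_powR; rewrite ?nnegrE ?powR_ge0 ?invr_ge0 ?(ltW p0)//.
  by apply: le_trans h; exact: powR_ge0.
have B0 : 0 < Bd by apply: le_lt_trans (bbB 0).
pose eps (j : nat) : R := Bd * 4^-1 ^+ j.
have e0 j : 0 < eps j by rewrite mulr_gt0// exprn_gt0// invr_gt0.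
have lev j := finite_superlevel p0 (e0 j) bb0 hM.
pose r j := sval (cid2 (lev j)).
have ur j : uniq (r j) by rewrite /r; case: cid2.
have hr j n : (n \in r j) = (eps j <= dyadic_mass g n) by rewrite /r; case: cid2.
pose N j := (\sum_(n <- r j) 4 * cell_count g (eps j) n)%N.
split.
  apply: (@bounded_operator_integral_operator _ (4 * (2 * Bd + 4 * 1))).
  by apply: (@schur_bounded_max_kernel _ g) => // n; exact: ltW.
apply: (@summable_of_thresholds _ _ p 48 _ eps N) => //.
- by move=> n; exact: singular_number_ge0.
- have -> : N 0%N = (\sum_(n <- r 0) 0)%N.
    apply: eq_big_seq => n; rewrite hr /eps expr0 mulr1 => h.
    by have := lt_le_trans (bbB n) h; rewrite ltxx.
  by rewrite big1_seq.
- move=> j n hn; apply: (@singular_number_max_kernel_le _ g _ g0 gn m1 m2 Phig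
    PhiV Bd B0 _ _ (e0 j) (r j)) => //.
  + by move=> k; exact: ltW.
  + by move=> k; rewrite hr.
- move=> J; apply: (@weighted_counts_le _ (dyadic_mass g)
    p M Bd eps r (fun j n => cell_count g (eps j) n)) => //.
  by move=> j n; exact: cell_count_le.
- move=> d d0; pose d' := d `^ p^-1; have d'0 : 0 < d' by exact: powR_gt0.
  (* The bound k < 4 ^ k is enough here. *)
  exists (Num.truncn (Bd / d')).+1.
  have -> : d = d' `^ p by rewrite -powRrM mulVf ?gt_eqF// powRr1 ?ltW.
  apply: ge0_ler_powR; rewrite ?nnegrE ?(ltW (e0 _)) ?(ltW p0) ?(ltW d'0)//.
  rewrite /eps exprVn ler_pdivrMr ?exprn_gt0// -ler_pdivrMl// mulrC.
  apply: (le_trans (ltW (truncnS_gt _))); rewrite -natrX ler_nat.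
  exact/ltnW/ltn_expl.
Qed.

(** If phi x = Phi x, then phi(max(x, y)) = Phi(max(x, y)) for almost every y:
for y <= x by the choice of x, and for y > x since phi and Phi agree almost
everywhere. *)
Lemma ae_eq_Qop (phi Phi f : R -> C) : cmeasurable phi ->
  measurable_fun (setT : set TR) (fun x : TR => complex.Re (Phi x)) ->
  measurable_fun (setT : set TR) (fun x : TR => complex.Im (Phi x)) ->
  ae_eq mu H phi Phi -> cmeasurable f ->
  ae_eq mu H (integral_operator (max_kernel Phi) f) (Qop phi f).
Proof.
move=> mphi m1 m2 ePhi mf.
have kphi : kmeasurable (max_kernel (crestrict phi)).
  apply: kmeasurable_max_kernel.
  - exact: measurable_Re_crestrict.
  - exact: measurable_Im_crestrict.
have kPhi : kmeasurable (max_kernel Phi) by exact: kmeasurable_max_kernel.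
have Hmax x y : H x -> H y -> H (Num.max x y).
  by move=> /halflineP x0 /halflineP y0; apply/halflineP; rewrite lt_max x0.
apply: filterS (ePhi) => x ex Hx.
have -> : Qop phi f x = integral_operator (max_kernel (crestrict phi)) f x.
  by apply: eq_cintegral => y Hy; rewrite /max_kernel crestrictE//; exact: Hmax.
apply: ae_eq_cintegral.
- by apply: cmeasurableM => //; exact: measurable_kernel_section.
- by apply: cmeasurableM => //; exact: measurable_kernel_section.
apply: filterS (ePhi) => y ey Hy; congr (_ * _).
rewrite /max_kernel crestrictE; last exact: Hmax.
by case: leP => _; [rewrite ey|rewrite ex].
Qed.

(** The sum of the four monotone functions dominates the values and the
variation of the real and of the imaginary part, and each of its summands is
controlled by [nonincreasing_Xp_sum_le]. *)
Lemma Yp_dominated (p : R) (phi : R -> C) : 0 < p -> Yp p phi ->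
  exists (Phi : R -> C) (g : R -> R) (M : R),
  [/\ measurable_fun (setT : set TR) (fun x : TR => complex.Re (Phi x)) /\
      measurable_fun (setT : set TR) (fun x : TR => complex.Im (Phi x)),
      (forall x, 0 < x -> 0 <= g x) /\
      (forall x y, 0 < x -> x <= y -> g y <= g x),
      (forall x, 0 < x -> cabs (Phi x) <= g x) /\
      (forall x y, 0 < x -> x <= y -> cabs (Phi y - Phi x) <= g x - g y),
      forall r : seq int, uniq r -> \sum_(n <- r) dyadic_mass g n `^ p <= M &
      ae_eq mu H phi Phi].
Proof.
move=> p0 [[mphi _] [g1 [g2 [h1 [h2 [X1 X2 X3 X4 [eRe eIm]]]]]]].
have mreal g : @nonincreasing_Xp R p g -> measurable_fun H g.
  by case=> _ [mg _]; exact: measurable_of_real mg.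
pose Phi x : C := if 0 < x then Complex (g1 x - g2 x) (h1 x - h2 x) else 0.
pose g x := (g1 x + g2 x) + (h1 x + h2 x).
have ge0 f : @nonincreasing_Xp R p f -> forall x, 0 < x -> 0 <= f x.
  exact: nonincreasing_Xp_ge0.
have mono f : @nonincreasing_Xp R p f -> forall x y, 0 < x -> x <= y -> f y <= f x.
  exact: nonincreasing_XpP.
have [M1 hM1] := nonincreasing_Xp_sum_le p0 X1.
have [M2 hM2] := nonincreasing_Xp_sum_le p0 X2.
have [M3 hM3] := nonincreasing_Xp_sum_le p0 X3.
have [M4 hM4] := nonincreasing_Xp_sum_le p0 X4.
have mext (f f' : R -> R) : measurable_fun H f -> measurable_fun H f' ->
    measurable_fun (setT : set TR) (fun x : TR => if 0 < x then f x - f' x else 0).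
  move=> mf mf'; have ->
    : (fun x : TR => if 0 < x then f x - f' x else 0) = (f \- f') \_ H.
    apply/funext => x; rewrite patchE.
    have [x0|x0] := ltP 0 x; first by rewrite mem_set//; apply/halflineP.
    by rewrite memNset// => /halflineP; rewrite ltNge x0.
  by apply/(measurable_restrictT _ _).1 => //; exact: measurable_funB.
have m1 : measurable_fun (setT : set TR) (fun x : TR => complex.Re (Phi x)).
  have -> : (fun x : TR => complex.Re (Phi x)) = (fun x =>
    if 0 < x then g1 x - g2 x else 0).
    by apply/funext => x; rewrite /Phi Re_if.
  by apply: mext; exact: mreal.
have m2 : measurable_fun (setT : set TR) (fun x : TR => complex.Im (Phi x)).
  have -> : (fun x : TR => complex.Im (Phi x)) = (fun x =>
    if 0 < x then h1 x - h2 x else 0).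
    by apply/funext => x; rewrite /Phi Im_if.
  by apply: mext; exact: mreal.
exists Phi, g, (2 `^ p * (2 `^ p * (M1 + M2) + 2 `^ p * (M3 + M4))); split=> //.
- split.
  + by move=> x x0; rewrite /g !addr_ge0// ge0.
  + by move=> x y x0 xy; rewrite /g !lerD// mono.
- split.
  + move=> x x0; apply: (le_trans (cabs_leD _)); rewrite /Phi x0 /=.
    have := ge0 _ X1 _ x0; have := ge0 _ X2 _ x0; have := ge0 _ X3 _ x0.
    have := ge0 _ X4 _ x0 => a4 a3 a2 a1.
    by apply: lerD; rewrite ler_norml; lra.
  + move=> x y x0 xy; apply: (le_trans (cabs_leD _)).
    have y0 : 0 < y by exact: lt_le_trans xy.
    rewrite /Phi x0 y0 /=.
    have := mono _ X1 _ _ x0 xy; have := mono _ X2 _ _ x0 xy.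
    have := mono _ X3 _ _ x0 xy; have := mono _ X4 _ _ x0 xy => a4 a3 a2 a1.
    rewrite /g [leRHS](_ : _ = (g1 x - g1 y + (g2 x - g2 y))
      + (h1 x - h1 y + (h2 x - h2 y))); last by ring.
    by apply: lerD; rewrite ler_norml; lra.
- move=> r ur.
  have bge f : @nonincreasing_Xp R p f -> forall n, 0 <= dyadic_mass f n.
    by move=> Xf n; apply: dyadic_mass_ge0; exact: ge0.
  apply: (@le_trans _ _ (\sum_(n <- r)
    2 `^ p * (2 `^ p * (dyadic_mass g1 n `^ p + dyadic_mass g2 n `^ p) +
      2 `^ p * (dyadic_mass h1 n `^ p + dyadic_mass h2 n `^ p)))).
    apply: ler_sum => n _.
    have -> : dyadic_mass g n = (dyadic_mass g1 n + dyadic_mass g2 n)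
      + (dyadic_mass h1 n + dyadic_mass h2 n) by rewrite /dyadic_mass /g; ring.
    have b1 := bge _ X1 n; have b2 := bge _ X2 n.
    have b3 := bge _ X3 n; have b4 := bge _ X4 n.
    apply: (le_trans (powRD_le _ _ p0)); rewrite ?addr_ge0//.
    by apply: ler_wpM2l; rewrite ?powR_ge0//; apply: lerD; exact: powRD_le.
  rewrite -mulr_sumr ler_wpM2l ?powR_ge0// big_split /= -!mulr_sumr !big_split /=.
  by apply: lerD; apply: ler_wpM2l; rewrite ?powR_ge0//; apply: lerD; auto.
- apply: (filterS2 _ _ eRe eIm) => x e1 e2 Hx; have x0 : 0 < x by apply/halflineP.
  have := e1 Hx; have := e2 Hx; rewrite /Phi x0.
  by case: (phi x) => a b /= -> ->.
Qed.

End SchattenMaxKernel.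

Theorem theorem5p1 (R : realType) (p : R) (hp : 2^-1 < p)
    (phi : R -> R[i]%type) (hphi : Yp p phi) : Q_in_schatten p phi.
Proof.
have p0 : 0 < p by apply: lt_trans hp; rewrite invr_gt0.
have [[mphi _] _] := hphi.
have [Phi [g [M [[m1 m2] [g0 gn] [Phig PhiV] hM ePhi]]]] := Yp_dominated p0 hphi.
exists (integral_operator (max_kernel Phi)); split;
  first exact: schatten_max_kernel Phig PhiV hM.
by move=> f [mf _ _]; exact: ae_eq_Qop.
Qed.
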